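(* Let a ''die'' be given by finitely many distinct nonzero integers $s_1,\dots,s_r$ with probabilities $q_1,\dots,q_r>0$, $\sum q_j=1$, and assume the expected gain $\sum_j q_j s_j$ is positive. A player starts with capital $0$ and at each round rolls the die independently and adds the outcome to the capital. Let $X$ be the number of rounds until the capital is strictly positive for the first time. Then the probability generating function $f(t)=\sum_{k\ge0}\Pr(X=k)t^k$ is an algebraic formal power series: there exists a nonzero two-variable polynomial $P(y,t)$ with $P(f(t),t)=0$. Furthermore, there is an algorithm for finding such a polynomial $P$. *)

(* Defs.v *)
From HB Require Import structures.
From mathcomp Require Import all_boot all_order all_algebra.
From mathcomp Require Import all_classical all_reals all_analysis.
Set Implicit Arguments.
Unset Strict Implicit.
Unset Printing Implicit Defensive.
Import Order.TTheory GRing.Theory Num.Theory.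
Local Open Scope classical_set_scope.
Local Open Scope ring_scope.

Record die (R : realType) := Die {
  faces : nat;
  outcome : 'I_faces -> int;
  weight : 'I_faces -> R;
  outcome_inj : injective outcome;
  outcome_neq0 : forall j, outcome j != 0;
  weight_gt0 : forall j, 0 < weight j;
  weight_sum1 : \sum_j weight j = 1 }.

Definition expected_gain (R : realType) (D : die R) : R :=
  \sum_j weight j * (outcome (d := D) j)%:~R.

Definition mutually_independent (d : measure_display) (T : measurableType d)
    (R : realType) (Pr : probability T R) (xi : nat -> {RV Pr >-> R}) : Prop :=
  forall (J : seq nat) (A : nat -> set R),
    uniq J -> (forall n, measurable (A n)) ->
    Pr (\bigcap_(n in [set` J]) (xi n @^-1` A n)) =
      (\prod_(n <- J) Pr (xi n @^-1` A n))%E.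

(* xi n is the outcome of round n + 1. *)
Definition independent_rolls (d : measure_display) (T : measurableType d)
    (R : realType) (Pr : probability T R) (D : die R)
    (xi : nat -> {RV Pr >-> R}) : Prop :=
  (forall n (j : 'I_(faces D)), pmf (xi n) (outcome j)%:~R = weight j) /\
  mutually_independent xi.

Definition capital (T : Type) (R : realType) (xi : nat -> T -> R)
    (k : nat) (w : T) : R := \sum_(i < k) xi i w.

(* None when the capital never becomes positive. *)
Definition rounds (T : Type) (R : realType) (xi : nat -> T -> R) (w : T) :
    option nat :=
  match pselect (exists k, 0 < capital xi k w) with
  | left ex => Some (ex_minn ex)
  | right _ => None
  end.

(* A formal power series in t is the sequence of its coefficients. *)
Definition pgf (d : measure_display) (T : measurableType d) (R : realType)
    (Pr : probability T R) (X : T -> option nat) : nat -> R :=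
  fun k => fine (Pr [set w | X w = Some k]).

Section FormalPowerSeries.
Variable R : nzRingType.

Definition fps_mul (f g : nat -> R) : nat -> R :=
  fun n => \sum_(i < n.+1) f i * g (n - i)%N.

Definition fps_one : nat -> R := fun n => (n == 0%N)%:R.

Definition fps_exp (f : nat -> R) (m : nat) : nat -> R :=
  iter m (fps_mul f) fps_one.

(* P(f(t), t) for P(y, t) given as a polynomial in y over polynomials in t. *)
Definition fps_subst (P : {poly {poly R}}) (f : nat -> R) : nat -> R :=
  fun n => \sum_(i < size P) fps_mul (fun k => P`_i`_k) (fps_exp f i) n.

Definition annihilates (P : {poly {poly R}}) (f : nat -> R) : Prop :=
  forall n, fps_subst P f n = 0.

Definition algebraic_fps (f : nat -> R) : Prop :=
  exists P : {poly {poly R}}, P != 0 /\ annihilates P f.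

End FormalPowerSeries.

(* Algorithms on data built from real numbers: programs over binary trees whose
   leaves may carry a number, with exact field arithmetic and comparison as
   unit steps (the uniform Blum-Shub-Smale model).  The syntax does not depend
   on the field and its only numeric constants are 0 and 1, so a program run on
   rational data only ever handles rationals and is then an algorithm in the
   ordinary sense. *)
Inductive program : Type :=
  | Id
  | Seq of program & program
  | EmptyTree
  | Fork of program & program
  | Fst
  | Snd
  | IsLeaf
  | Zero
  | One
  | Add
  | Opp
  | Mul
  | Inv
  | Leq
  | If of program & program & program
  | While of program & program.

Inductive tree (F : Type) : Type :=
  | Empty
  | Leaf of F
  | Node of tree F & tree F.
Arguments Empty {F}.

(* Truth values: Empty is false, every other tree is true. *)
Definition truth (F : Type) (b : bool) : tree F :=
  if b then Node Empty Empty else Empty.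

Definition is_leaf (F : Type) (x : tree F) : bool :=
  if x is Leaf _ then true else false.

(* [run p x y]: started on x, the program p halts with result y.  Arithmetic on
   anything but numbers, and the inverse of 0, have no result. *)
Inductive run (F : realFieldType) : program -> tree F -> tree F -> Prop :=
  | run_Id x : run Id x x
  | run_Seq p q x y z : run p x y -> run q y z -> run (Seq p q) x z
  | run_EmptyTree x : run EmptyTree x Empty
  | run_Fork p q x y z : run p x y -> run q x z -> run (Fork p q) x (Node y z)
  | run_Fst x y : run Fst (Node x y) x
  | run_Snd x y : run Snd (Node x y) y
  | run_IsLeaf x : run IsLeaf x (truth F (is_leaf x))
  | run_Zero x : run Zero x (Leaf 0)
  | run_One x : run One x (Leaf 1)
  | run_Add a b : run Add (Node (Leaf a) (Leaf b)) (Leaf (a + b))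
  | run_Opp a : run Opp (Leaf a) (Leaf (- a))
  | run_Mul a b : run Mul (Node (Leaf a) (Leaf b)) (Leaf (a * b))
  | run_Inv a : a != 0 -> run Inv (Leaf a) (Leaf a^-1)
  | run_Leq a b : run Leq (Node (Leaf a) (Leaf b)) (truth F (a <= b))
  | run_If_true c p q x v y :
      run c x v -> v <> Empty -> run p x y -> run (If c p q) x y
  | run_If_false c p q x y :
      run c x Empty -> run q x y -> run (If c p q) x y
  | run_While_stop c p x : run c x Empty -> run (While c p) x x
  | run_While_step c p x v y z :
      run c x v -> v <> Empty -> run p x y -> run (While c p) y z ->
      run (While c p) x z.

Lemma run_functional (F : realFieldType) (p : program) (x y z : tree F) :
  run p x y -> run p x z -> y = z.
Proof.
move=> pxy; elim: pxy z => {p x y}; intros;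
  match goal with H : run _ _ ?u |- _ = ?u => inversion H; subst end;
  repeat match goal with
  | IH : forall u, run ?p ?x u -> ?v = u, H : run ?p ?x ?w |- _ =>
      move: (IH _ H) => ?; clear H; subst
  end; by [].
Qed.

Definition encode_seq (F : Type) (s : seq (tree F)) : tree F :=
  foldr (@Node F) Empty s.

Definition encode_die (R : realType) (D : die R) : tree R :=
  encode_seq [seq Node (Leaf (outcome j)%:~R) (Leaf (weight j))
             | j <- enum 'I_(faces D)].

Definition encode_poly2 (R : nzRingType) (P : {poly {poly R}}) : tree R :=
  encode_seq [seq encode_seq [seq Leaf c | c <- polyseq p] | p <- polyseq P].

(* Main.v *)
Require Import Defs.
From HB Require Import structures.
From mathcomp Require Import all_boot all_order all_algebra.
From mathcomp Require Import all_classical all_reals all_analysis.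
From mathcomp Require Import fieldext ring zify.
Local Open Scope classical_set_scope.
Local Open Scope ring_scope.
Set Implicit Arguments.
Unset Strict Implicit.
Unset Printing Implicit Defensive.
Import Order.TTheory GRing.Theory Num.Theory.

(** Let F_l(t) be the generating function of the first passage above 0 landing at l,
    and b a bound on the outcomes s_j.  To pass above 0 from a state c <= 0 the walk first
    passes above c, so first passage functions obey, in c, the recurrence whose
    characteristic polynomial is the ladder polynomial A(w) = w^b - \sum_l F_l w^(b-l); they
    also obey the one-step recurrence.  Hence every root w of A, in an extension of
    the field of fractions of R[[t]], is a root of the kernel
    w^b - t \sum_j q_j w^(b-s_j), and 1 - f = A(1) is a product of b numbers 1 - w with w
    a root of the kernel.

    A polynomial with this root is computed without solving anything: Newton's
    identities give the power sums p_k of the numbers 1 - w, scaled by a leading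
    coefficient to make them integral over R[t]; p_k^b is the k-th power sum of all
    their b-fold products; Newton's identities then give back the polynomial whose
    roots are these products. *)

(** * Formal power series and splitting fields *)

(** The wrapper keeps the convolution product apart from the pointwise operations that functions
    already carry. *)
Record fps (R : nzRingType) := FPS { fps_coef : nat -> R }.

Section FpsZmodule.
Variable R : nzRingType.
Implicit Types f g h : fps R.

HB.instance Definition _ := gen_eqMixin (fps R).
HB.instance Definition _ := gen_choiceMixin (fps R).

Lemma fps_ext f g : fps_coef f =1 fps_coef g -> f = g.
Proof. by case: f g => f [g] /= /funext ->. Qed.

Definition fps_add f g : fps R := FPS (fun n => fps_coef f n + fps_coef g n).
Definition fps_opp f : fps R := FPS (fun n => - fps_coef f n).
Definition fps_zero : fps R := FPS (fun=> 0).

Lemma fps_addA : associative fps_add.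
Proof. by move=> f g h; apply: fps_ext => n /=; rewrite addrA. Qed.
Lemma fps_addC : commutative fps_add.
Proof. by move=> f g; apply: fps_ext => n /=; rewrite addrC. Qed.
Lemma fps_add0 : left_id fps_zero fps_add.
Proof. by move=> f; apply: fps_ext => n /=; rewrite add0r. Qed.
Lemma fps_addN : left_inverse fps_zero fps_opp fps_add.
Proof. by move=> f; apply: fps_ext => n /=; rewrite addNr. Qed.

HB.instance Definition _ :=
  GRing.isZmodule.Build (fps R) fps_addA fps_addC fps_add0 fps_addN.

Lemma fps_coefD f g n : fps_coef (f + g) n = fps_coef f n + fps_coef g n.
Proof. by []. Qed.
Lemma fps_coef_sum I (s : seq I) (P : pred I) (F : I -> fps R) n :
  fps_coef (\sum_(i <- s | P i) F i) n = \sum_(i <- s | P i) fps_coef (F i) n.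
Proof. exact: (big_morph (fun f => fps_coef f n)). Qed.

End FpsZmodule.

Section FpsRing.
Variable R : comNzRingType.
Implicit Types f g h : fps R.

Definition fps_prod f g : fps R := FPS (fps_mul (fps_coef f) (fps_coef g)).
Definition fps_unit1 : fps R := FPS (fps_one R).

(** Coefficient [n] of a product involves only coefficients up to [n] of the factors, so the ring
    laws are inherited from polynomials by truncation. *)
Definition fps_trunc n f : {poly R} := \poly_(i < n.+1) fps_coef f i.

Lemma coef_fps_trunc n f i : (i <= n)%N -> (fps_trunc n f)`_i = fps_coef f i.
Proof. by move=> le_in; rewrite coef_poly ltnS le_in. Qed.

Lemma coef_fps_truncM n f g i : (i <= n)%N ->
  (fps_trunc n f * fps_trunc n g)`_i = fps_coef (fps_prod f g) i.
Proof.
move=> le_in; rewrite coefM; apply: eq_bigr => j _.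
have le_ji : (j <= i)%N by rewrite -ltnS.
by rewrite !coef_fps_trunc // (leq_trans _ le_in) // leq_subr.
Qed.

(** [p] may be any polynomial agreeing with [g] up to degree [n]: for associativity it is a product
    of truncations, which need not be the truncation of the product. *)
Lemma fps_coefM_trunc n f (p : {poly R}) g :
    (forall i, (i <= n)%N -> p`_i = fps_coef g i) ->
  fps_coef (fps_prod f g) n = (fps_trunc n f * p)`_n.
Proof.
move=> pE; rewrite -(@coef_fps_truncM n) // !coefM; apply: eq_bigr => j _.
by rewrite (coef_fps_trunc _ (leq_subr _ _)) pE ?leq_subr.
Qed.

Lemma fps_prodC : commutative fps_prod.
Proof.
move=> f g; apply: fps_ext => n.
by rewrite -!(@coef_fps_truncM n) // mulrC.
Qed.

Lemma fps_prodA : associative fps_prod.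
Proof.
move=> f g h; apply: fps_ext => n; rewrite [in RHS]fps_prodC.
rewrite (@fps_coefM_trunc n f (fps_trunc n g * fps_trunc n h)); last first.
  by move=> i /coef_fps_truncM.
rewrite (@fps_coefM_trunc n h (fps_trunc n f * fps_trunc n g)).
  by rewrite mulrA mulrC.
by move=> i /coef_fps_truncM.
Qed.

Lemma fps_prod1 : left_id fps_unit1 fps_prod.
Proof.
move=> f; apply: fps_ext => n; rewrite fps_prodC /= /fps_mul.
rewrite (bigD1 ord_max) //= subnn mulr1 big1 ?addr0 // => i ne_in.
by rewrite /fps_one subn_eq0 leqNgt ltn_neqAle ne_in -ltnS ltn_ord mulr0.
Qed.

Lemma fps_prodDl : left_distributive fps_prod +%R.
Proof.
move=> f g h; apply: fps_ext => n.
by rewrite fps_coefD /= /fps_mul -big_split; apply: eq_bigr => i _; rewrite mulrDl.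
Qed.

Lemma fps_unit1_neq0 : fps_unit1 != 0.
Proof.
by apply/eqP => /(congr1 (fun f => fps_coef f 0)) /eqP; rewrite /= oner_eq0.
Qed.

HB.instance Definition _ := GRing.Zmodule_isComNzRing.Build (fps R)
  fps_prodA fps_prodC fps_prod1 fps_prodDl fps_unit1_neq0.

Lemma fps_coefM f g n :
  fps_coef (f * g) n = \sum_(i < n.+1) fps_coef f i * fps_coef g (n - i)%N.
Proof. by []. Qed.

Lemma fps_expE f m : fps_coef (f ^+ m) = fps_exp (fps_coef f) m.
Proof. by elim: m => [|m IHm] //; rewrite exprS /fps_exp iterS -/(fps_exp _ _) -IHm. Qed.

Definition fps_of_poly (p : {poly R}) : fps R := FPS (fun n => p`_n).

Lemma fps_of_poly_additive : zmod_morphism fps_of_poly.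
Proof. by move=> p q; apply: fps_ext => n /=; rewrite coefB. Qed.
Lemma fps_of_poly_multiplicative : monoid_morphism fps_of_poly.
Proof.
split=> [|p q]; apply: fps_ext => n /=; first by rewrite coef1.
by rewrite coefM.
Qed.
HB.instance Definition _ := GRing.isZmodMorphism.Build _ _ fps_of_poly
  fps_of_poly_additive.
HB.instance Definition _ := GRing.isMonoidMorphism.Build _ _ fps_of_poly
  fps_of_poly_multiplicative.

Lemma fps_of_poly_eq0 p : (fps_of_poly p == 0) = (p == 0).
Proof.
apply/eqP/eqP => [p0|->]; last exact: rmorph0.
by apply/polyP => n; move/(congr1 (fun f => fps_coef f n)): p0; rewrite coef0.
Qed.

(** This turns annihilation, stated coefficient by coefficient, into being a root in the ring
    [fps R]. *)
Lemma fps_subst_horner (P : {poly {poly R}}) f :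
  fps_subst P (fps_coef f) =1 fps_coef (map_poly fps_of_poly P).[f].
Proof.
move=> n; rewrite (@horner_coef_wide _ (size P)) ?size_poly //.
rewrite fps_coef_sum; apply: eq_bigr => i _.
by rewrite coef_map /= -fps_expE.
Qed.

Lemma fps_coef_XM f n : fps_coef (fps_of_poly 'X * f) n.+1 = fps_coef f n.
Proof.
rewrite fps_coefM big_ord_recl /= coefX mul0r add0r big_ord_recl /= coefX mul1r.
rewrite subSS subn0 big1 ?addr0 // => i _.
by rewrite coefX mul0r.
Qed.

Lemma fps_coef_XM0 f : fps_coef (fps_of_poly 'X * f) 0 = 0.
Proof. by rewrite fps_coefM big_ord1 /= coefX mul0r. Qed.

Lemma fps_coef_CM c f n : fps_coef (fps_of_poly c%:P * f) n = c * fps_coef f n.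
Proof.
rewrite fps_coefM big_ord_recl /= coefC /= subn0 big1 ?addr0 // => i _.
by rewrite coefC mul0r.
Qed.

(** Inverses are chosen classically; the unit ring structure is the base on which the integral
    domain, and then its field of fractions, are built. *)
Definition fps_unit : pred (fps R) := fun f => `[< exists g, g * f = 1 >].
Definition fps_inv f : fps R :=
  if pselect (exists g, g * f = 1) is left ex then projT1 (cid ex) else f.

Lemma fps_mulVf : {in fps_unit, left_inverse 1 fps_inv *%R}.
Proof.
move=> f; rewrite unfold_in => /asboolP ex; rewrite /fps_inv.
by case: pselect => // ex'; case: cid.
Qed.
Lemma fps_unitP f g : g * f = 1 -> fps_unit f.
Proof. by move=> gf1; apply/asboolP; exists g. Qed.
Lemma fps_inv_out : {in [predC fps_unit], fps_inv =1 id}.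
Proof.
move=> f /asboolP nex; rewrite /fps_inv.
by case: pselect.
Qed.
HB.instance Definition _ := GRing.ComNzRing_hasMulInverse.Build (fps R)
  fps_mulVf fps_unitP fps_inv_out.

End FpsRing.

Section FpsDomain.
Variable R : idomainType.
Implicit Types f g : fps R.

Lemma fps_order f : f != 0 ->
  exists i, fps_coef f i != 0 /\ forall j, (j < i)%N -> fps_coef f j = 0.
Proof.
move=> f_neq0; have ex : exists i, fps_coef f i != 0.
  apply: contrapT => /forallNP f0; case/eqP: f_neq0.
  by apply: fps_ext => i; apply/eqP; apply: contraT => /f0.
exists (ex_minn ex); case: ex_minnP => i fi_neq0 min_i; split=> // j lt_ji.
by apply: contraTeq lt_ji => /min_i; rewrite leqNgt.
Qed.

(** With [i] and [j] the orders of [f] and [g], coefficient [i + j] of the product reduces to the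
    product of the two lowest coefficients. *)
Lemma fps_integral : GRing.integral_domain_axiom (fps R).
Proof.
move=> f g fg0; apply/norP => -[/fps_order[i [fi f0]] /fps_order[j [gj g0]]].
move/(congr1 (fun h => fps_coef h (i + j))): fg0; rewrite fps_coefM.
have lti : (i < (i + j).+1)%N by rewrite ltnS leq_addr.
rewrite (bigD1 (Ordinal lti)) //= addKn big1 ?addr0 => [/eqP|k neki].
  by rewrite mulf_eq0 (negPf fi) (negPf gj).
move: neki; rewrite -val_eqE /=; case: (ltngtP k i) => [/f0->||]; rewrite ?mul0r // => ltik _.
by rewrite g0 ?mulr0 // ltn_subLR ?ltn_add2r // -ltnS.
Qed.
HB.instance Definition _ := GRing.ComUnitRing_isIntegral.Build (fps R) fps_integral.
End FpsDomain.

(** * Splitting fields of polynomials over an arbitrary field *)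

Lemma irreducible_factor (F : fieldType) (p : {poly F}) : (1 < size p)%N ->
  exists2 q, irreducible_poly q & q %| p.
Proof.
have [n] := ubnP (size p); elim: n p => // n IHn p le_pn p_gt1.
have [irr|] := pselect (irreducible_poly p); first by exists p.
move/not_andP => [|/existsNP[q /not_implyP[q1 /not_implyP[qp nqp]]]] //.
have p0 : p != 0 by rewrite -size_poly_gt0 ltnW.
have q0 : q != 0 by apply: contraTneq qp => ->; rewrite dvd0p.
have ltqp : (size q < size p)%N.
  by rewrite ltn_neqAle dvdp_leq // andbT dvdp_size_eqp //; apply/negP.
have [||r irr rq] := IHn q; first exact: leq_trans ltqp _.
  by rewrite ltn_neqAle eq_sym q1 size_poly_gt0.
by exists r => //; apply: dvdp_trans rq qp.
Qed.

(** A root of an irreducible factor is adjoined and its linear factor divided out; the induction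
    then continues over the larger field, so [F] has to vary with [p]. *)
Lemma splitting_field (F : fieldType) (p : {poly F}) : p != 0 ->
  exists (L : fieldType) (iota : {rmorphism F -> L}) (rs : seq L),
    map_poly iota p = iota (lead_coef p) *: \prod_(r <- rs) ('X - r%:P).
Proof.
have [n] := ubnP (size p); elim: n F p => // n IHn F p le_pn p0.
have [le_p1|p_gt1] := leqP (size p) 1.
  exists F, idfun, [::]; rewrite big_nil map_poly_id //.
  by rewrite (size1_polyC le_p1) lead_coefC alg_polyC.
have [q irr /dvdpP[p' pE]] := irreducible_factor p_gt1.
have [L _ [z rootz _]] := irredp_FAdjoin irr.
have /factor_theorem[s sE] : root (map_poly (in_alg L) p) z.
  by rewrite pE rmorphM rootM rootz orbT.
have s0 : s != 0.
  apply: contraTneq p0 => s0; move: sE; rewrite s0 mul0r => /eqP.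
  by rewrite map_poly_eq0 negbK.
have [|//|M [iota [rs sM]]] := IHn L s.
  move: (congr1 (fun x : {poly L} => size x) sE).
  by rewrite /= size_map_poly size_Mmonic ?monicXsubC // size_XsubC addn2 /= => <-.
exists M, (iota \o in_alg L), (iota z :: rs).
rewrite map_poly_comp sE rmorphM /= sM big_cons map_polyXsubC mulrC -scalerAr.
have -> // : lead_coef s = in_alg L (lead_coef p).
by rewrite -lead_coef_map sE lead_coefM lead_coefXsubC mulr1.
Qed.

(** * Computable functions *)

Section ComputableBasics.
Variable R : realType.

(** One program serves all arguments. It has to halt on encodings only; its behaviour on other trees
    is left open. *)
Definition computable (A B : Type) (eA : A -> tree R) (eB : B -> tree R)
  (f : A -> B) : Prop := exists p, forall x, run p (eA x) (eB (f x)).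

Definition enc_pair (A B : Type) (eA : A -> tree R) (eB : B -> tree R)
  (x : A * B) : tree R := Node (eA x.1) (eB x.2).
Definition enc_seq (A : Type) (eA : A -> tree R) (s : seq A) : tree R :=
  encode_seq (map eA s).
(** Unary notation makes a natural number a list, so that iteration is a fold. *)
Definition enc_nat (n : nat) : tree R := encode_seq (nseq n Defs.Empty).
Definition enc_poly (A : nzRingType) (eA : A -> tree R) (p : {poly A}) : tree R :=
  enc_seq eA p.

Section Closure.
Variables (X A B C : Type).
Variables (eX : X -> tree R) (eA : A -> tree R) (eB : B -> tree R) (eC : C -> tree R).

Lemma computable_id : computable eX eX id.
Proof. by exists Id => x; apply: run_Id. Qed.

Lemma computable_comp (f : X -> A) (g : A -> B) :
  computable eX eA f -> computable eA eB g -> computable eX eB (fun x => g (f x)).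
Proof.
by move=> [p pP] [q qP]; exists (Seq p q) => x; apply: run_Seq (pP x) (qP _).
Qed.

Lemma computable_pair (f : X -> A) (g : X -> B) :
  computable eX eA f -> computable eX eB g ->
  computable eX (enc_pair eA eB) (fun x => (f x, g x)).
Proof.
by move=> [p pP] [q qP]; exists (Fork p q) => x; apply: run_Fork.
Qed.

Lemma computable_fst (f : X -> A * B) :
  computable eX (enc_pair eA eB) f -> computable eX eA (fun x => (f x).1).
Proof.
move=> [p pP]; exists (Seq p Fst) => x; apply: run_Seq (pP x) _; exact: run_Fst.
Qed.

Lemma computable_snd (f : X -> A * B) :
  computable eX (enc_pair eA eB) f -> computable eX eB (fun x => (f x).2).
Proof.
move=> [p pP]; exists (Seq p Snd) => x; apply: run_Seq (pP x) _; exact: run_Snd.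
Qed.

Lemma computable_comp2 (op : A -> B -> C) (f : X -> A) (g : X -> B) :
    computable (enc_pair eA eB) eC (fun u => op u.1 u.2) ->
    computable eX eA f -> computable eX eB g ->
  computable eX eC (fun x => op (f x) (g x)).
Proof.
move=> cop cf cg.
by have [p pP] := computable_pair cf cg; have [q qP] := cop;
  exists (Seq p q) => x; apply: run_Seq (pP x) (qP _).
Qed.

Lemma computable_if (c : X -> bool) (f g : X -> A) :
    computable eX (truth R) c -> computable eX eA f -> computable eX eA g ->
  computable eX eA (fun x => if c x then f x else g x).
Proof.
move=> [r rP] [p pP] [q qP]; exists (If r p q) => x; move: (rP x).
by case: (c x) => [/run_If_true|/run_If_false]; apply.
Qed.

Lemma computable_nil : computable eX (enc_seq eA) (fun=> [::]).
Proof. by exists EmptyTree => x; apply: run_EmptyTree. Qed.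

Lemma computable_cons (f : X -> A) (g : X -> seq A) :
    computable eX eA f -> computable eX (enc_seq eA) g ->
  computable eX (enc_seq eA) (fun x => f x :: g x).
Proof. by move=> [p pP] [q qP]; exists (Fork p q) => x; apply: run_Fork. Qed.

Lemma computable_head (d : X -> A) (f : X -> seq A) :
    computable eX eA d -> computable eX (enc_seq eA) f ->
  computable eX eA (fun x => head (d x) (f x)).
Proof.
move=> [q qP] [p pP]; exists (If p (Seq p Fst) q) => x; move: (pP x).
case: (f x) => [|a s] px; first by apply: run_If_false px _.
by apply: (run_If_true _ px) => //; apply: run_Seq px _; apply: run_Fst.
Qed.

Lemma computable_behead (f : X -> seq A) :
  computable eX (enc_seq eA) f -> computable eX (enc_seq eA) (fun x => behead (f x)).
Proof.
move=> [p pP]; exists (If p (Seq p Snd) EmptyTree) => x; move: (pP x).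
case: (f x) => [|a s] px; first by apply: run_If_false px _; apply: run_EmptyTree.
by apply: (run_If_true _ px) => //; apply: run_Seq px _; apply: run_Snd.
Qed.

Lemma computable_nilp (f : X -> seq A) :
  computable eX (enc_seq eA) f -> computable eX (truth R) (fun x => nilp (f x)).
Proof.
move=> [p pP]; exists (If p EmptyTree (Fork EmptyTree EmptyTree)) => x; move: (pP x).
case: (f x) => [|a s] px.
  by apply: run_If_false px _; apply: run_Fork; apply: run_EmptyTree.
by apply: (run_If_true _ px) => //; apply: run_EmptyTree.
Qed.

(** This loop underlies the other recursions on lists and on unary numbers, which are rewritten as
    left folds. *)
Lemma computable_foldl (body : X -> C -> A -> C) (z : X -> C) (s : X -> seq A) :
    computable (enc_pair eX (enc_pair eC eA)) eC (fun u => body u.1 u.2.1 u.2.2) ->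
    computable eX eC z -> computable eX (enc_seq eA) s ->
  computable eX eC (fun x => foldl (body x) (z x) (s x)).
Proof.
move=> [p pP] [q qP] [r rP].
(* The state holds the remaining list, then the parameter and the accumulator. The list itself is
   the loop test, since [Empty] encodes both the empty list and false. *)
pose step := Fork (Seq Fst Snd)
  (Fork (Seq Snd Fst) (Seq (Fork (Seq Snd Fst) (Fork (Seq Snd Snd) (Seq Fst Fst))) p)).
exists (Seq (Fork r (Fork Id q)) (Seq (While Fst step) (Seq Snd Snd))) => x.
apply: (@run_Seq _ _ _ _ (Node (enc_seq eA (s x)) (Node (eX x) (eC (z x))))).
  by apply: run_Fork => //; apply: run_Fork => //; apply: run_Id.
move: (s x) (z x) => {qP rP} l c.
apply: (@run_Seq _ _ _ _ (Node Defs.Empty (Node (eX x) (eC (foldl (body x) c l))))).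
  elim: l c => [|a l IHl] c; first by apply: run_While_stop; apply: run_Fst.
  apply: run_While_step (IHl _); [exact: run_Fst| by []|].
  apply: run_Fork; first by apply: run_Seq (run_Fst _ _) (run_Snd _ _).
  apply: run_Fork; first by apply: run_Seq (run_Snd _ _) (run_Fst _ _).
  apply: run_Seq (pP (x, (c, a))); apply: run_Fork.
    by apply: run_Seq (run_Snd _ _) (run_Fst _ _).
  apply: run_Fork; first by apply: run_Seq (run_Snd _ _) (run_Snd _ _).
  by apply: run_Seq (run_Fst _ _) (run_Fst _ _).
by apply: run_Seq (run_Snd _ _) (run_Snd _ _).
Qed.

End Closure.

Lemma computable_ext (X A : Type) (eX : X -> tree R) (eA : A -> tree R)
    (f g : X -> A) : f =1 g -> computable eX eA g -> computable eX eA f.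
Proof. by move=> /funext ->. Qed.

End ComputableBasics.

Arguments enc_nat {R} n.

(** Settles the goals that merely route data through projections, pairs and lists. *)
Ltac comp_proj := cbv beta; repeat
  lazymatch goal with
  | |- computable _ _ (fun x => x) => exact: computable_id
  | |- computable _ _ id => exact: computable_id
  | |- computable _ _ (@fst _ _) => eapply (computable_fst (f := id))
  | |- computable _ _ (@snd _ _) => eapply (computable_snd (f := id))
  | |- computable _ _ (fun x => fst (@?f x)) => eapply computable_fst
  | |- computable _ _ (fun x => snd (@?f x)) => eapply computable_snd
  | |- computable _ _ (fun x => (@?f x) :: (@?g x)) => apply: computable_cons
  | |- computable _ _ (fun x => [::]) => exact: computable_nil
  | |- computable _ _ (fun x => (@?f x, @?g x)) => apply: computable_pair
  end.

Section ComputableData.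
Variable R : realType.

Section Lists.
Variables (X A B C : Type).
Variables (eX : X -> tree R) (eA : A -> tree R) (eB : B -> tree R) (eC : C -> tree R).

Lemma computable_rev (s : X -> seq A) :
  computable eX (enc_seq eA) s -> computable eX (enc_seq eA) (fun x => rev (s x)).
Proof.
move=> cs; apply: (@computable_ext _ _ _ _ _ _
  (fun x => foldl (fun t a => a :: t) [::] (s x))).
  by move=> x; rewrite /rev; elim: (s x) [::] => //= a t IHt u.
by apply: computable_foldl cs; comp_proj.
Qed.

Lemma computable_foldr (body : X -> A -> C -> C) (z : X -> C) (s : X -> seq A) :
    computable (enc_pair eX (enc_pair eA eC)) eC (fun u => body u.1 u.2.1 u.2.2) ->
    computable eX eC z -> computable eX (enc_seq eA) s ->
  computable eX eC (fun x => foldr (body x) (z x) (s x)).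
Proof.
move=> cb cz cs; apply: (@computable_ext _ _ _ _ _ _
  (fun x => foldl (fun c a => body x a c) (z x) (rev (s x)))).
  by move=> x; rewrite foldl_rev.
apply: computable_foldl => //; last exact: computable_rev.
have cu : computable (enc_pair eX (enc_pair eC eA)) (enc_pair eX (enc_pair eA eC))
  (fun u => (u.1, (u.2.2, u.2.1))) by comp_proj.
exact: computable_comp cu cb.
Qed.

End Lists.

Section MapRcons.
Variables (X A B : Type).
Variables (eX : X -> tree R) (eA : A -> tree R) (eB : B -> tree R).

Lemma computable_map (body : X -> A -> B) (s : X -> seq A) :
    computable (enc_pair eX eA) eB (fun u => body u.1 u.2) ->
    computable eX (enc_seq eA) s ->
  computable eX (enc_seq eB) (fun x => map (body x) (s x)).
Proof.
move=> cb cs; apply: (@computable_ext _ _ _ _ _ _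
  (fun x => foldr (fun a t => body x a :: t) [::] (s x))) => //.
apply: computable_foldr cs; comp_proj.
have cu : computable (enc_pair eX (enc_pair eA (enc_seq eB))) (enc_pair eX eA)
  (fun u => (u.1, u.2.1)) by comp_proj.
exact: computable_comp cu cb.
Qed.

Lemma computable_rcons (s : X -> seq A) (a : X -> A) :
    computable eX (enc_seq eA) s -> computable eX eA a ->
  computable eX (enc_seq eA) (fun x => rcons (s x) (a x)).
Proof.
move=> cs ca; apply: (@computable_ext _ _ _ _ _ _
  (fun x => foldr cons [:: a x] (s x))) => [x|].
  by elim: (s x) => //= b t ->.
by apply: computable_foldr => //; comp_proj.
Qed.

End MapRcons.

(** * Unary natural numbers *)

Section Naturals.
Variables (X C : Type) (eX : X -> tree R) (eC : C -> tree R).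
Implicit Types m n : X -> nat.

Lemma computable_nat0 : computable eX enc_nat (fun=> 0%N).
Proof. by exists EmptyTree => x; apply: run_EmptyTree. Qed.

Lemma computable_succ n :
  computable eX enc_nat n -> computable eX enc_nat (fun x => (n x).+1).
Proof.
by move=> [p pP]; exists (Fork EmptyTree p) => x; apply: run_Fork => //; apply: run_EmptyTree.
Qed.

(** A number and the list of that many units have the same encoding, so programs on lists apply to
    numbers unchanged. *)
Let unary (n : nat) : seq unit := nseq n tt.
Let enc_unit (u : unit) : tree R := Defs.Empty.

Let computable_unary n : computable eX enc_nat n <->
  computable eX (enc_seq enc_unit) (fun x => unary (n x)).
Proof.
rewrite /computable /enc_nat /enc_seq.
by split=> -[p pP]; exists p => x; move: (pP x); rewrite map_nseq.
Qed.

Lemma computable_iter (body : X -> C -> C) (z : X -> C) n :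
    computable (enc_pair eX eC) eC (fun u => body u.1 u.2) ->
    computable eX eC z -> computable eX enc_nat n ->
  computable eX eC (fun x => iter (n x) (body x) (z x)).
Proof.
move=> cb cz /computable_unary cn; apply: (@computable_ext _ _ _ _ _ _
  (fun x => foldl (fun c _ => body x c) (z x) (unary (n x)))) => [x|].
  by elim: (n x) (z x) => // k IHk c; rewrite iterSr IHk.
apply: computable_foldl cz cn.
have cu : computable (enc_pair eX (enc_pair eC enc_unit)) (enc_pair eX eC)
  (fun u => (u.1, u.2.1)) by comp_proj.
exact: computable_comp cu cb.
Qed.

Lemma computable_pred n :
  computable eX enc_nat n -> computable eX enc_nat (fun x => (n x).-1).
Proof.
move=> /computable_unary /computable_behead cn; apply/computable_unary.
by apply: computable_ext cn => x; case: (n x).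
Qed.

Lemma computable_eqn0 n :
  computable eX enc_nat n -> computable eX (truth R) (fun x => n x == 0)%N.
Proof.
move=> /computable_unary /computable_nilp cn.
by apply: computable_ext cn => x; case: (n x).
Qed.

End Naturals.

Section NatArithmetic.
Variables (X A : Type) (eX : X -> tree R) (eA : A -> tree R).
Implicit Types m n : X -> nat.

Lemma computable_addn m n : computable eX enc_nat m -> computable eX enc_nat n ->
  computable eX enc_nat (fun x => m x + n x)%N.
Proof.
move=> cm cn; apply: (@computable_ext _ _ _ _ _ _ (fun x => iter (m x) succn (n x))).
  by move=> x; rewrite iter_succn addnC.
by apply: computable_iter => //; apply: computable_succ; comp_proj.
Qed.

Lemma computable_subn m n : computable eX enc_nat m -> computable eX enc_nat n ->
  computable eX enc_nat (fun x => m x - n x)%N.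
Proof.
move=> cm cn; apply: (@computable_ext _ _ _ _ _ _ (fun x => iter (n x) predn (m x))).
  by move=> x; rewrite iter_predn.
by apply: computable_iter => //; apply: computable_pred; comp_proj.
Qed.

Lemma computable_size (s : X -> seq A) : computable eX (enc_seq eA) s ->
  computable eX enc_nat (fun x => size (s x)).
Proof.
move=> cs; apply: (@computable_ext _ _ _ _ _ _ (fun x => foldr (fun _ k => k.+1) 0%N (s x))).
  by move=> x; elim: (s x) => //= a t ->.
apply: computable_foldr cs; last exact: computable_nat0.
by apply: computable_succ; comp_proj.
Qed.

Lemma computable_nth (d : X -> A) (s : X -> seq A) n :
    computable eX eA d -> computable eX (enc_seq eA) s -> computable eX enc_nat n ->
  computable eX eA (fun x => nth (d x) (s x) (n x)).
Proof.
move=> cd cs cn; apply: (@computable_ext _ _ _ _ _ _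
  (fun x => head (d x) (iter (n x) behead (s x)))).
  move=> x; elim: (n x) (s x) => [|k IHk] [|a t] //; last by rewrite iterSr -IHk.
  by rewrite iterSr -IHk /= nth_nil.
apply: computable_head => //; apply: computable_iter => //.
by apply: computable_behead; comp_proj.
Qed.

Lemma computable_iota n : computable eX enc_nat n ->
  computable eX (enc_seq enc_nat) (fun x => iota 0 (n x)).
Proof.
move=> cn; apply: (@computable_ext _ _ _ _ _ _
  (fun x => iter (n x) (fun s => 0%N :: map succn s) [::])).
  move=> x; elim: (n x) => //= k <-; rewrite (iotaDl 1).
  by congr cons; apply: eq_map => i.
apply: computable_iter => //; last exact: computable_nil.
apply: computable_cons; first exact: computable_nat0.
apply: computable_map; last by comp_proj.
by apply: computable_succ; comp_proj.
Qed.

End NatArithmetic.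

Lemma computable_muln (X : Type) (eX : X -> tree R) (m n : X -> nat) :
    computable eX enc_nat m -> computable eX enc_nat n ->
  computable eX enc_nat (fun x => m x * n x)%N.
Proof.
move=> cm cn; apply: (@computable_ext _ _ _ _ _ _
  (fun x => iter (m x) (addn (n x)) 0%N)).
  by move=> x; rewrite iter_addn_0 mulnC.
apply: computable_iter => //; last exact: computable_nat0.
apply: computable_addn; comp_proj.
by apply: (computable_comp (f := fst) _ cn); comp_proj.
Qed.

Lemma computable_expn (X : Type) (eX : X -> tree R) (m n : X -> nat) :
    computable eX enc_nat m -> computable eX enc_nat n ->
  computable eX enc_nat (fun x => m x ^ n x)%N.
Proof.
move=> cm cn; apply: (@computable_ext _ _ _ _ _ _
  (fun x => iter (n x) (muln (m x)) 1%N)).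
  by move=> x; elim: (n x) => // k IHk; rewrite expnS IHk.
apply: computable_iter => //; last exact/computable_succ/computable_nat0.
apply: computable_muln; comp_proj.
by apply: (computable_comp (f := fst) _ cm); comp_proj.
Qed.

Lemma natceil_ex (x : R) : exists n, x <= n%:R.
Proof.
exists (Num.Def.archi_bound `|x|).
by rewrite (le_trans (ler_norm x)) // ltW // archi_boundP.
Qed.
Definition natceil (x : R) : nat := ex_minn (natceil_ex x).

Lemma natceil_nat n : natceil n%:R = n.
Proof.
rewrite /natceil; case: ex_minnP => m; rewrite ler_nat => le_nm min_m.
by apply/eqP; rewrite eqn_leq le_nm min_m.
Qed.

(** The program counts up from 0 while [x <= k] fails, keeping the count [k] both as a numeric leaf,
    for the comparison, and in unary, for the result. *)
Lemma computable_natceil (X : Type) (eX : X -> tree R) (f : X -> R) :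
  computable eX (@Leaf R) f -> computable eX enc_nat (fun x => natceil (f x)).
Proof.
move=> [q qP]; suff [p pP] : computable (@Leaf R) enc_nat natceil.
  by exists (Seq q p) => x; apply: run_Seq (qP x) (pP _).
pose below := If (Seq (Fork Fst (Seq Snd Fst)) Leq) EmptyTree (Fork EmptyTree EmptyTree).
pose step := Fork Fst (Fork (Seq (Fork (Seq Snd Fst) One) Add) (Fork EmptyTree (Seq Snd Snd))).
exists (Seq (Fork Id (Fork Zero EmptyTree)) (Seq (While below step) (Seq Snd Snd))) => x.
pose state k := Node (Leaf x) (Node (Leaf k%:R) (enc_nat k)).
apply: (@run_Seq _ _ _ _ (state 0%N)).
  apply: run_Fork; first exact: run_Id.
  by apply: run_Fork; [exact: run_Zero | exact: run_EmptyTree].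
apply: (@run_Seq _ _ _ _ (state (natceil x))); last first.
  by apply: run_Seq (run_Snd _ _) (run_Snd _ _).
have below_state k : run (Seq (Fork Fst (Seq Snd Fst)) Leq) (state k) (truth R (x <= k%:R)).
  apply: run_Seq (run_Leq _ _); apply: run_Fork; first exact: run_Fst.
  by apply: run_Seq (run_Snd _ _) (run_Fst _ _).
rewrite /natceil; case: ex_minnP => n le_xn min_n.
(* Induction on the number [k] of rounds still to run, the current count being [n - k]. *)
rewrite -(subnn n); have := leqnn n; elim: {1 4}n => [|k IHk] le_kn.
  rewrite subn0; apply: run_While_stop; apply: (run_If_true _ (below_state n)).
    by rewrite le_xn.
  exact: run_EmptyTree.
have lt_n : (n - k.+1 < n)%N by rewrite ltn_subrL (leq_trans _ le_kn).
have nle : (x <= (n - k.+1)%:R) = false.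
  by apply: contraTF lt_n => /min_n; rewrite -leqNgt.
have nk : (n - k = (n - k.+1).+1)%N by rewrite -subSn // subSS.
apply: run_While_step (IHk (ltnW le_kn)).
- apply: run_If_false; first by rewrite -[Defs.Empty]/(truth R false) -nle; apply: below_state.
  by apply: run_Fork; apply: run_EmptyTree.
- by [].
- apply: run_Fork; first exact: run_Fst.
  rewrite nk; apply: run_Fork.
    rewrite mulrSr; apply: run_Seq (run_Add _ _); apply: run_Fork; last exact: run_One.
    by apply: run_Seq (run_Snd _ _) (run_Fst _ _).
  apply: run_Fork; first exact: run_EmptyTree.
  by apply: run_Seq (run_Snd _ _) (run_Snd _ _).
Qed.

(** * Rings with computable operations, and polynomials over them *)

Section Rings.

(** The zero test is needed because the encoding of a polynomial is its normalized list, without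
    leading zeros. *)
Record computable_ring (A : nzRingType) (eA : A -> tree R) : Prop := ComputableRing {
  computable_ring0 : forall (X : Type) (eX : X -> tree R), computable eX eA (fun=> 0);
  computable_ring1 : forall (X : Type) (eX : X -> tree R), computable eX eA (fun=> 1);
  computable_ringD : computable (enc_pair eA eA) eA (fun u => u.1 + u.2);
  computable_ringN : computable eA eA -%R;
  computable_ringM : computable (enc_pair eA eA) eA (fun u => u.1 * u.2);
  computable_ring_eq0 : computable eA (truth R) (fun a => a == 0) }.

Variables (A : nzRingType) (eA : A -> tree R).
Hypothesis cA : computable_ring eA.
Variables (X : Type) (eX : X -> tree R).
Implicit Types (f g : X -> A).

Lemma computable_add f g : computable eX eA f -> computable eX eA g ->
  computable eX eA (fun x => f x + g x).
Proof. exact/computable_comp2/computable_ringD. Qed.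

Lemma computable_mul f g : computable eX eA f -> computable eX eA g ->
  computable eX eA (fun x => f x * g x).
Proof. exact/computable_comp2/computable_ringM. Qed.

Lemma computable_opp f : computable eX eA f -> computable eX eA (fun x => - f x).
Proof. by move=> cf; apply: computable_comp cf (computable_ringN cA). Qed.

Lemma computable_eq0 f : computable eX eA f ->
  computable eX (truth R) (fun x => f x == 0).
Proof. by move=> cf; apply: computable_comp cf (computable_ring_eq0 cA). Qed.

End Rings.

Section RingIterations.
Variables (A : nzRingType) (eA : A -> tree R) (cA : computable_ring eA).
Variables (X I : Type) (eX : X -> tree R) (eI : I -> tree R).

Lemma computable_exp (f : X -> A) (n : X -> nat) :
    computable eX eA f -> computable eX enc_nat n ->
  computable eX eA (fun x => f x ^+ n x).
Proof.
move=> cf cn; apply: (@computable_ext _ _ _ _ _ _ (fun x => iter (n x) ( *%R (f x)) 1)).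
  by move=> x; elim: (n x) => //= k <-; rewrite exprS.
apply: computable_iter cn; last exact: computable_ring1.
apply: computable_mul => //; comp_proj.
by apply: (computable_comp (f := fst) _ cf); comp_proj.
Qed.

Lemma computable_natr (n : X -> nat) :
  computable eX enc_nat n -> computable eX eA (fun x => (n x)%:R).
Proof.
move=> cn; apply: (@computable_ext _ _ _ _ _ _ (fun x => iter (n x) (+%R 1) 0)).
  by move=> x; elim: (n x) => //= k <-; rewrite mulrS.
apply: computable_iter cn; last exact: computable_ring0.
by apply: computable_add => //; comp_proj; apply: computable_ring1.
Qed.

Lemma computable_sum (E : X -> I -> A) (s : X -> seq I) :
    computable (enc_pair eX eI) eA (fun u => E u.1 u.2) ->
    computable eX (enc_seq eI) s ->
  computable eX eA (fun x => \sum_(i <- s x) E x i).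
Proof.
move=> cE cs; apply: (@computable_ext _ _ _ _ _ _
  (fun x => foldr (fun i a => E x i + a) 0 (s x))).
  by move=> x; rewrite unlock.
apply: computable_foldr cs; last exact: computable_ring0.
have cu : computable (enc_pair eX (enc_pair eI eA)) (enc_pair eX eI)
  (fun u => (u.1, u.2.1)) by comp_proj.
apply: computable_add => //; comp_proj.
exact: computable_comp cu cE.
Qed.

Lemma computable_sum_nat (E : X -> nat -> A) (n : X -> nat) :
    computable (enc_pair eX enc_nat) eA (fun u => E u.1 u.2) ->
    computable eX enc_nat n ->
  computable eX eA (fun x => \sum_(0 <= i < n x) E x i).
Proof.
move=> cE cn; apply: (@computable_ext _ _ _ _ _ _
  (fun x => foldr (fun i a => E x i + a) 0 (iota 0 (n x)))).
  by move=> x; rewrite /index_iota subn0 unlock.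
apply: computable_foldr (computable_iota cn); last exact: computable_ring0.
have cu : computable (enc_pair eX (enc_pair enc_nat eA)) (enc_pair eX enc_nat)
  (fun u => (u.1, u.2.1)) by comp_proj.
apply: computable_add => //; comp_proj.
exact: computable_comp cu cE.
Qed.

(** The list is built from the top coefficient down, and a zero is dropped as long as the list is
    still empty; this is where the zero test enters. *)
Lemma computable_poly (E : X -> nat -> A) (n : X -> nat) :
    computable (enc_pair eX enc_nat) eA (fun u => E u.1 u.2) ->
    computable eX enc_nat n ->
  computable eX (enc_poly eA) (fun x => \poly_(i < n x) E x i).
Proof.
move=> cE cn; apply: (@computable_ext _ _ _ _ _ _
  (fun x => foldr (fun i p => cons_poly (E x i) p) 0 (iota 0 (n x)))).
  by move=> x; rewrite unlock /mkseq /Poly foldr_map.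
apply: computable_foldr (computable_iota cn); last first.
  by have [p pP] := computable_nil eX eA; exists p => x; move: (pP x); rewrite /enc_poly polyseq0.
have [p pP] : computable (enc_pair eX (enc_pair enc_nat (enc_poly eA))) (enc_seq eA)
    (fun u => if nilp u.2.2 then if E u.1 u.2.1 == 0 then [::] else [:: E u.1 u.2.1]
              else E u.1 u.2.1 :: u.2.2).
  have cu : computable (enc_pair eX (enc_pair enc_nat (enc_poly eA))) (enc_pair eX enc_nat)
    (fun u => (u.1, u.2.1)) by comp_proj.
  have cE' : computable (enc_pair eX (enc_pair enc_nat (enc_poly eA))) eA
    (fun u => E u.1 u.2.1) := computable_comp cu cE.
  have cp : computable (enc_pair eX (enc_pair enc_nat (enc_poly eA))) (enc_seq eA)
    (fun u => polyseq u.2.2).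
    by have : computable (enc_pair eX (enc_pair enc_nat (enc_poly eA))) (enc_poly eA)
      (fun u => u.2.2) by comp_proj.
  apply: computable_if; first exact: computable_nilp cp.
    by apply: computable_if; [exact: (computable_eq0 cA cE') | comp_proj.. ].
  by comp_proj.
exists p => u; move: (pP u); rewrite /enc_poly polyseq_cons.
by case: u => x [i q] /=; case: nilP => //= _; rewrite polyseqC; case: eqP.
Qed.

End RingIterations.

Lemma computable_ring_num : computable_ring (@Leaf R).
Proof.
split=> [X eX|X eX||||].
- by exists Zero => x; apply: run_Zero.
- by exists One => x; apply: run_One.
- by exists Add => -[x y]; apply: run_Add.
- by exists Opp => x; apply: run_Opp.
- by exists Mul => -[x y]; apply: run_Mul.
(* The only primitive test on numbers is [Leq], so vanishing is two comparisons. *)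
- apply: (@computable_ext _ _ _ _ _ _ (fun a => if a <= 0 then 0 <= a else false)).
    by move=> a; rewrite eq_le; case: (a <= 0).
  have cle : computable (enc_pair (@Leaf R) (@Leaf R)) (truth R) (fun u => u.1 <= u.2).
    by exists Leq => -[x y]; apply: run_Leq.
  have c0 : computable (@Leaf R) (@Leaf R) (fun=> 0) by exists Zero => x; apply: run_Zero.
  apply: computable_if; first by apply: (computable_comp2 cle _ c0); comp_proj.
    by apply: (computable_comp2 cle c0); comp_proj.
  by exists EmptyTree => x; apply: run_EmptyTree.
Qed.

Lemma computable_inv (X : Type) (eX : X -> tree R) (f : X -> R) :
  computable eX (@Leaf R) f -> computable eX (@Leaf R) (fun x => (f x)^-1).
Proof.
move=> cf; suff ci : computable (@Leaf R) (@Leaf R) GRing.inv by apply: computable_comp cf ci.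
have [p pP] := computable_eq0 computable_ring_num (computable_id (@Leaf R)).
(* [Inv] has no result at 0, whereas [0^-1 = 0] in the field: there the argument itself is
   returned. *)
exists (If p Id Defs.Inv) => x; move: (pP x); case: eqP => [->|/eqP x0] px.
  by rewrite invr0; apply: (run_If_true _ px) => //; apply: run_Id.
by apply: (run_If_false _ px); apply: run_Inv.
Qed.

Section PolyRing.
Variables (A : nzRingType) (eA : A -> tree R) (cA : computable_ring eA).

Lemma computable_coef (X : Type) (eX : X -> tree R) (p : X -> {poly A}) (n : X -> nat) :
    computable eX (enc_poly eA) p -> computable eX enc_nat n ->
  computable eX eA (fun x => (p x)`_(n x)).
Proof. by move=> cp cn; apply: computable_nth => //; apply: computable_ring0. Qed.

Lemma computable_size_poly (X : Type) (eX : X -> tree R) (p : X -> {poly A}) :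
  computable eX (enc_poly eA) p -> computable eX enc_nat (fun x => size (p x)).
Proof. exact: computable_size. Qed.

Lemma computable_polyC (X : Type) (eX : X -> tree R) (c : X -> A) :
  computable eX eA c -> computable eX (enc_poly eA) (fun x => (c x)%:P).
Proof.
move=> cc; apply: (@computable_ext _ _ _ _ _ _ (fun x => \poly_(i < 1) c x)).
  by move=> x; apply/polyP => -[|i]; rewrite coefC coef_poly.
apply: computable_poly => //; last exact/computable_succ/computable_nat0.
by apply: (computable_comp (f := fst) _ cc); comp_proj.
Qed.

Lemma computable_polyX (X : Type) (eX : X -> tree R) :
  computable eX (enc_poly eA) (fun=> 'X).
Proof.
apply: (@computable_ext _ _ _ _ _ _ (fun x => \poly_(i < 2) i%:R)).
  by move=> x; apply/polyP => -[|[|i]]; rewrite coefX coef_poly.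
apply: computable_poly => //; first by apply: computable_natr => //; comp_proj.
exact/computable_succ/computable_succ/computable_nat0.
Qed.

(** Since the property passes from [A] to [{poly A}], two applications reach polynomials in two
    variables. *)
Lemma computable_ring_poly : computable_ring (enc_poly eA).
Proof.
split=> [X eX|X eX||||].
- by apply: computable_polyC; apply: computable_ring0.
- by apply: computable_polyC; apply: computable_ring1.
(* Here and for the product, any upper bound on the size will do, as [\poly] normalizes. *)
- apply: (@computable_ext _ _ _ _ _ _
    (fun u : {poly A} * {poly A} => \poly_(i < (size u.1 + size u.2)%N) (u.1`_i + u.2`_i))).
    move=> u; apply/polyP => i; rewrite coefD coef_poly; case: ltnP => // le_i.
    by rewrite !nth_default ?addr0 // (leq_trans _ le_i) ?leq_addr ?leq_addl.
  apply: computable_poly => //; last first.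
    by apply: computable_addn; apply: computable_size_poly; comp_proj.
  by apply: computable_add => //; apply: computable_coef; comp_proj.
- apply: (@computable_ext _ _ _ _ _ _ (fun p : {poly A} => \poly_(i < size p) - p`_i)).
    move=> p; apply/polyP => i; rewrite coefN coef_poly; case: ltnP => // le_i.
    by rewrite nth_default ?oppr0.
  apply: computable_poly => //; last by apply: computable_size_poly; comp_proj.
  by apply: computable_opp => //; apply: computable_coef; comp_proj.
- apply: (@computable_ext _ _ _ _ _ _ (fun u : {poly A} * {poly A} =>
    \poly_(i < (size u.1 + size u.2)%N) \sum_(0 <= j < i.+1) (u.1`_j * u.2`_(i - j)%N))).
    move=> [p q]; apply/polyP => i /=; rewrite coef_poly big_mkord -coefM.
    case: ltnP => // le_i; rewrite nth_default // (leq_trans (size_polyMleq _ _)) //.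
    by rewrite (leq_trans (leq_pred _)).
  apply: computable_poly => //; last first.
    by apply: computable_addn; apply: computable_size_poly; comp_proj.
  apply: computable_sum_nat => //; last by apply: computable_succ; comp_proj.
  apply: computable_mul => //; apply: computable_coef; comp_proj.
  by apply: computable_subn; comp_proj.
- apply: (@computable_ext _ _ _ _ _ _ (fun p => nilp (polyseq p))).
    by move=> p; rewrite -size_poly_eq0.
  exact/computable_nilp/computable_id.
Qed.

End PolyRing.
End ComputableData.

(** * Newton's identities *)

Section NewtonIdentities.
Variable A : comNzRingType.
Implicit Type s : seq A.

(** The reciprocal of the monic polynomial with roots [s]: coefficient [k] is, up to sign, the
    elementary symmetric function of degree [k], with no reference to the length of [s]. *)
Definition rev_poly s : {poly A} := \prod_(u <- s) (1 - u *: 'X).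

Lemma coef_rev_poly_cons u s k : (rev_poly (u :: s))`_k =
  (rev_poly s)`_k - (if k is k'.+1 then u * (rev_poly s)`_k' else 0).
Proof.
rewrite /rev_poly big_cons mulrBl mul1r coefB -scalerAl coefZ coefXM.
by case: k => [|k] /=; rewrite ?mulr0.
Qed.

Lemma coef0_rev_poly s : (rev_poly s)`_0 = 1.
Proof.
by elim: s => [|u s IHs]; rewrite ?coef_rev_poly_cons ?subr0 // /rev_poly big_nil coef1.
Qed.

(** Induction on the list of roots covers all [k] at once, including those beyond the number of
    roots. *)
Lemma newton_identity s k :
  \sum_(i < k) (rev_poly s)`_i * \sum_(u <- s) u ^+ (k - i) = - ((rev_poly s)`_k *+ k).
Proof.
elim: s k => [|u s IHs] k.
  rewrite big1 => [|i _]; last by rewrite big_nil mulr0.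
  by case: k => [|k]; rewrite ?mulr0n ?oppr0 // /rev_poly big_nil coef1 mul0rn oppr0.
case: k => [|k]; first by rewrite big_ord0 mulr0n oppr0.
set p := fun m => \sum_(v <- s) v ^+ m; set e := rev_poly s.
pose P m := u ^+ m + p m.
have PE m : \sum_(v <- u :: s) v ^+ m = P m by rewrite big_cons.
(* The new root multiplies [rev_poly s] by [1 - u *: 'X], which gives the sum for [e] minus [u]
   times the sum one degree lower. *)
transitivity (\sum_(i < k.+1) e`_i * P (k.+1 - i)%N - u * \sum_(i < k) e`_i * P (k - i)%N).
  rewrite !big_ord_recl /= coef_rev_poly_cons subr0 PE -addrA; congr (_ + _).
  rewrite mulr_sumr -sumrB; apply: eq_bigr => i _.
  by rewrite coef_rev_poly_cons PE subSS mulrBl mulrA.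
under eq_bigr do rewrite mulrDr; rewrite big_split /= IHs.
under [in X in u * X]eq_bigr do rewrite mulrDr; rewrite big_split /= IHs.
rewrite coef_rev_poly_cons -/e big_ord_recr /= subSnn expr1.
(* The powers of [u] now cancel between the two sums, except in the term of index [k]. *)
have -> : u * (\sum_(i < k) e`_i * u ^+ (k - i) - e`_k *+ k)
    = \sum_(i < k) e`_i * u ^+ (k.+1 - i) - u * e`_k *+ k.
  rewrite mulrBr mulrnAr mulr_sumr; congr (_ - _); apply: eq_bigr => i _.
  by rewrite subSn ?exprS 1?mulrCA // ltnW.
by set S := \sum_(i < k) _; ring.
Qed.

Lemma coef_rev_poly_gt s k : (size s < k)%N -> (rev_poly s)`_k = 0.
Proof.
elim: s k => [|u s IHs] [|k] //= lt_sk; first by rewrite /rev_poly big_nil coef1.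
by rewrite coef_rev_poly_cons !IHs ?mulr0 ?subr0 // ltnW.
Qed.

Lemma coef_prod_XsubC_rev s i : (i <= size s)%N ->
  (\prod_(u <- s) ('X - u%:P))`_(size s - i) = (rev_poly s)`_i.
Proof.
elim: s i => [|u s IHs] i le_is.
  by rewrite /rev_poly !big_nil; case: i le_is.
rewrite coef_rev_poly_cons big_cons mulrBl coefB coefXM coefCM /=.
case: i le_is => [|i] le_is.
  rewrite subn0 /= -[X in _`_X - _]subn0 IHs // [X in _ - u * X]nth_default ?mulr0 //.
  by rewrite size_prod_XsubC.
rewrite subSS IHs // subn_eq0 leqNgt; case: ltnP => /= lt_is.
  by rewrite -(IHs i.+1) // subnS.
by rewrite (@coef_rev_poly_gt s i.+1).
Qed.

End NewtonIdentities.

Section CourseOfValues.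
Variables (A : Type) (step : seq A -> A).

(** Recursion on all earlier values becomes plain iteration on their list, a form covered by
    [computable_iter]. *)
Definition course n : seq A := iter n (fun s => rcons s (step s)) [::].

Lemma size_course n : size (course n) = n.
Proof. by elim: n => //= n IHn; rewrite size_rcons IHn. Qed.

Lemma nth_course d i n : (i < n)%N -> nth d (course n) i = step (course i).
Proof.
elim: n => // n IHn; rewrite ltnS leq_eqVlt => /predU1P[->|lt_in] /=.
  by rewrite nth_rcons size_course ltnn eqxx.
by rewrite nth_rcons size_course lt_in IHn.
Qed.

End CourseOfValues.

Section NewtonAlgorithm.
Variable A : comNzRingType.

(* The power sums in degrees k > 0 of the roots u of \prod_u (1 - u X) with
   coefficients r; the value in degree 0 is 0 instead of the number of roots. *)
Definition psum_step (r : nat -> A) (s : seq A) : A :=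
  - ((size s)%:R * r (size s) + \sum_(0 <= i < size s) r (size s - i)%N * s`_i).
Definition newton_psum r k := psum_step r (course (psum_step r) k).

(** Newton's identity is solved for the coefficient, which requires dividing by its degree. [A] need
    not be a field, so inverses of the positive integers are supplied as [inv]. *)
Definition coef_step (inv p : nat -> A) (s : seq A) : A :=
  if size s == 0%N then 1
  else - inv (size s) * \sum_(0 <= i < size s) s`_i * p (size s - i)%N.
Definition newton_coef inv p k := coef_step inv p (course (coef_step inv p) k).

Lemma newton_psumE r k : newton_psum r k =
  - (k%:R * r k + \sum_(0 <= i < k) r (k - i)%N * newton_psum r i).
Proof.
rewrite {1}/newton_psum /psum_step size_course; congr (- (_ + _)).
by apply: eq_big_nat => i /andP[_ lt_ik]; rewrite nth_course.
Qed.

Lemma newton_coefE inv p k : newton_coef inv p k = if k == 0%N then 1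
  else - inv k * \sum_(0 <= i < k) newton_coef inv p i * p (k - i)%N.
Proof.
rewrite {1}/newton_coef /coef_step size_course; case: eqP => // _; congr (_ * _).
by apply: eq_big_nat => i /andP[_ lt_ik]; rewrite nth_course.
Qed.

Variables (L : comNzRingType) (phi : {rmorphism A -> L}).

(** The computation stays in [A]; the roots exist only in [L], where its image is compared with
    their power sums. *)
Lemma newton_psum_correct (r : nat -> A) (s : seq L) :
    (forall k, phi (r k) = (rev_poly s)`_k) ->
  forall k, phi (newton_psum r k) = if k == 0%N then 0 else \sum_(u <- s) u ^+ k.
Proof.
move=> rE; elim/ltn_ind => k IHk; rewrite newton_psumE mulr_natl rmorphN rmorphD rmorphMn.
rewrite rmorph_sum /= rE; case: k IHk => [|k] IHk.
  by rewrite big_geq // mulr0n addr0 oppr0.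
under eq_big_nat => i /andP[_ lti].
  rewrite rmorphM rE IHk //; over.
(* The value 0 in degree 0 removes the term that would hold the number of roots; Newton's identity
   has no such term. *)
rewrite big_nat_recl //= mulr0 add0r.
have := newton_identity s k.+1; rewrite big_ord_recl /= coef0_rev_poly mul1r subn0.
move/(canRL (addrK _)) => ->; rewrite opprD; congr (_ - _).
rewrite big_nat_rev big_mkord; apply: eq_bigr => i _.
by rewrite add0n !subSS subKn // -subSn.
Qed.

Lemma newton_coef_correct (inv p : nat -> A) (s : seq L) :
    (forall k, (0 < k)%N -> phi (p k) = \sum_(u <- s) u ^+ k) ->
    (forall k, (0 < k)%N -> phi (inv k) * k%:R = 1) ->
  forall k, phi (newton_coef inv p k) = (rev_poly s)`_k.
Proof.
move=> pE invE; elim/ltn_ind => k IHk; rewrite newton_coefE.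
case: eqP => [->|/eqP]; rewrite ?coef0_rev_poly ?rmorph1 // -lt0n => k_gt0.
rewrite rmorphM rmorphN rmorph_sum /=.
under eq_big_nat => i /andP[_ lti].
  rewrite rmorphM IHk // pE ?subn_gt0 //; over.
by rewrite big_mkord newton_identity mulrNN -mulr_natl mulrA invE // mul1r.
Qed.

End NewtonAlgorithm.

(** * Power sums of products of roots *)

Section MultiProducts.
Variable A : comNzRingType.
Implicit Types s t : seq A.

(** All words of length [b] are kept, repetitions of a factor included, so that by distributivity
    each power sum is exactly a [b]-th power. *)
Definition multiproducts b s : seq A :=
  iter b (fun t => [seq u * v | u <- s, v <- t]) [:: 1].

Lemma size_multiproducts b s : size (multiproducts b s) = (size s ^ b)%N.
Proof. by elim: b => //= b IHb; rewrite size_allpairs IHb expnS. Qed.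

Lemma psum_multiproducts b s k :
  \sum_(v <- multiproducts b s) v ^+ k = (\sum_(u <- s) u ^+ k) ^+ b.
Proof.
elim: b => [|b IHb]; first by rewrite big_seq1 expr1n.
rewrite /= big_allpairs_dep exprS mulr_suml; apply: eq_bigr => u _.
by rewrite -IHb mulr_sumr; apply: eq_bigr => v _; rewrite exprMn.
Qed.

(** As words may repeat a factor, inclusion as sets is enough, whatever the multiplicities in
    [t]. *)
Lemma mem_multiproducts s t : {subset t <= s} ->
  \prod_(u <- t) u \in multiproducts (size t) s.
Proof.
elim: t => [|u t IHt] ts; first by rewrite big_nil mem_seq1.
rewrite big_cons; apply: allpairs_f; first exact/ts/mem_head.
by apply: IHt => v vt; apply/ts/mem_behead.
Qed.

End MultiProducts.

Section ProductPoly.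
Variables (A : comNzRingType) (N : {poly A}) (b : nat) (inv : nat -> A).

(* If N has roots z, these are the coefficients of \prod_z (1 - lead_coef N * z X). *)
Definition scaled_coef k : A :=
  if k == 0%N then 1 else lead_coef N ^+ k.-1 * (rev N)`_k.

(* This vanishes at y when 1 - y is a product of b roots of N. *)
Definition product_poly : {poly A} :=
  let D := ((size N).-1 ^ b)%N in
  \sum_(0 <= k < D.+1)
    (newton_coef inv (fun i => newton_psum scaled_coef i ^+ b) k)%:P *
    ((lead_coef N ^+ b)%:P * (1 - 'X)) ^+ (D - k).

Variables (L : fieldType) (phi : {rmorphism A -> L}) (zs : seq L).
Let c := phi (lead_coef N).
Hypothesis lead_neq0 : c != 0.
Hypothesis N_split : map_poly phi N = c *: \prod_(z <- zs) ('X - z%:P).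
Hypothesis invE : forall k, (0 < k)%N -> phi (inv k) * k%:R = 1.

Let size_N : size N = (size zs).+1.
Proof.
by rewrite -(size_map_poly_id0 lead_neq0) N_split size_scale // size_prod_XsubC.
Qed.

Let us := [seq c * z | z <- zs].

Let scaled_coefE k : phi (scaled_coef k) = (rev_poly us)`_k.
Proof.
rewrite /scaled_coef; case: eqP => [->|/eqP]; first by rewrite rmorph1 coef0_rev_poly.
have -> : (rev_poly us)`_k = c ^+ k * (rev_poly zs)`_k.
  rewrite /us; elim: (zs) k => [|z s IHs] [|k].
  - by rewrite !coef0_rev_poly mul1r.
  - by rewrite /rev_poly !big_nil coef1 mulr0.
  - by rewrite !coef0_rev_poly mul1r.
  - by rewrite /= !coef_rev_poly_cons !IHs exprS; ring.
case: k => // k _; have [lt_k|ge_k] := ltnP k (size zs); last first.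
  by rewrite nth_default ?size_rev ?size_N // mulr0 rmorph0 coef_rev_poly_gt ?mulr0.
(* A coefficient of [N] already carries one factor [c], whence the exponent [k.-1] in
   [scaled_coef]. *)
rewrite nth_rev ?size_N // subSS -coef_prod_XsubC_rev // rmorphM rmorphXn /=.
by rewrite -[phi N`_(_ - _)]coef_map N_split coefZ mulrA -exprSr.
Qed.

(** The roots [y] are those with [c ^+ b * (1 - y)] in [multiproducts b us]; the power of [c]
    accounts for the scaling of the [b] factors. *)
Lemma map_product_poly : map_poly phi product_poly =
  (\prod_(v <- multiproducts b us) ('X - v%:P)) \Po (c ^+ b *: (1 - 'X)).
Proof.
set vs := multiproducts b us; set p := \prod_(v <- vs) _.
have D_E : ((size N).-1 ^ b)%N = size vs by rewrite size_multiproducts size_map size_N.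
have psumE k : (0 < k)%N ->
    phi (newton_psum scaled_coef k ^+ b) = \sum_(v <- vs) v ^+ k.
  rewrite psum_multiproducts rmorphXn /= (newton_psum_correct scaled_coefE).
  by case: eqP => // ->.
(* The sum is reversed so that coefficients of [rev_poly] meet those of the monic product in
   complementary degree. *)
rewrite comp_polyE size_prod_XsubC /product_poly D_E rmorph_sum big_nat_rev big_mkord.
apply: eq_bigr => k _; have le_k : (k <= size vs)%N by rewrite -ltnS.
rewrite add0n subSS subKn // rmorphM /= map_polyC /= (newton_coef_correct psumE invE).
rewrite -coef_prod_XsubC_rev ?leq_subr // subKn // rmorphXn rmorphM rmorphB rmorph1 /=.
by rewrite map_polyC map_polyX /= rmorphXn /= !mul_polyC.
Qed.

(** Substituting a polynomial of degree 1 into a monic polynomial cannot give 0. *)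
Lemma product_poly_neq0 : product_poly != 0.
Proof.
have nz : map_poly phi product_poly != 0.
  rewrite map_product_poly comp_poly_eq0 ?monic_neq0 ?monic_prod_XsubC //.
  rewrite size_scale ?expf_neq0 // -size_opp opprB.
  by rewrite -[1]/(1%:P) size_XsubC.
by apply: contraNneq nz => ->; rewrite rmorph0.
Qed.

Lemma root_product_poly ws : size ws = b -> {subset ws <= zs} ->
  root (map_poly phi product_poly) (1 - \prod_(w <- ws) w).
Proof.
move=> size_ws ws_zs; rewrite map_product_poly /root horner_comp.
rewrite hornerZ hornerD hornerN hornerX hornerC opprB addrCA subrr addr0 -/(root _ _).
rewrite root_prod_XsubC.
have -> : c ^+ b * \prod_(w <- ws) w = \prod_(u <- [seq c * w | w <- ws]) u.
  by rewrite big_map big_split /= big_const_seq count_predT size_ws iter_mulr_1.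
have -> : b = size [seq c * w | w <- ws] by rewrite size_map.
apply: mem_multiproducts => u /mapP[w w_ws ->].
by apply/map_f/ws_zs.
Qed.

End ProductPoly.

(** * First passage of the walk *)

Section FirstPassage.
Variables (R : realType) (D : die R).
Implicit Types (v : int -> R) (s c k : int).

(* The expectation of v(position at the first passage) over the event that the
   walk started at s is positive for the first time after n rounds. *)
Fixpoint passage v (n : nat) s : R :=
  if n is n'.+1 then
    if 0 < s then 0 else \sum_j weight j * passage v n' (s + outcome (d := D) j)
  else if 0 < s then v s else 0.

(** Used as the value function, it selects landing at [k]; the constant 1 instead counts every first
    passage. *)
Definition kron k s : R := (s == k)%:R.

Variable b : nat.
Hypothesis outcome_le : forall j, outcome (d := D) j <= b%:Z.

Lemma passage_gt0 v n s : 0 < s -> passage v n s = if n is 0 then v s else 0.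
Proof. by case: n => [|n] /= ->. Qed.

Lemma passage_le0 v n s : s <= 0 -> passage v n s =
  if n is n'.+1 then \sum_j weight j * passage v n' (s + outcome (d := D) j) else 0.
Proof. by case: n => [|n] /=; rewrite leNgt; case: ltP. Qed.

(** The walk starts above [c], so only [i = 0] and [l.+1 = s - c] contribute; the bound on [s - c]
    keeps this [l] in range. *)
Lemma passage_ladder_gt v n c s : c < s -> s - c <= b%:Z -> passage v n s =
  \sum_(l < b) \sum_(i < n.+1) passage (kron l.+1%:Z) i (s - c) * passage v (n - i) (c + l.+1%:Z).
Proof.
move=> s_gtc s_le; have sc_gt0 : 0 < s - c by rewrite subr_gt0.
have lt_sb : (`|s - c|.-1 < b)%N by lia.
rewrite (bigD1 (Ordinal lt_sb)) //= [X in _ + X]big1 ?addr0 => [|l ne_l].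
  rewrite big_ord_recl (passage_gt0 _ _ sc_gt0) /= sc_gt0 big1 ?addr0 => [|i _]; last first.
    by rewrite mul0r.
  by rewrite subn0 /kron prednK; [case: eqP => [_|]; rewrite ?mul1r; [congr passage|]; lia | lia].
rewrite big1 // => -[[|i] /= lt_i] _; rewrite sc_gt0 ?mul0r // /kron.
case: eqP => [scE|]; rewrite ?mul0r //.
by case/eqP: ne_l; apply: val_inj; rewrite /= scE.
Qed.

(* A walk started at s first exceeds c <= 0, landing at some c + l + 1, and only
   then exceeds 0. *)
Lemma passage_ladder v n c s : c <= 0 -> s - c <= b%:Z ->
  passage v n s =
  \sum_(l < b) \sum_(i < n.+1) passage (kron l.+1%:Z) i (s - c) * passage v (n - i) (c + l.+1%:Z).
Proof.
move=> c_le0; elim: n s => [|n IHn] s s_le; have [s_gtc|s_lec] := ltP c s.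
- exact: passage_ladder_gt.
- rewrite passage_le0 ?(le_trans s_lec) // big1 // => l _.
  by rewrite big_ord1 passage_le0 ?mul0r // subr_le0.
- exact: passage_ladder_gt.
- rewrite passage_le0 ?(le_trans s_lec) //.
  (* From [s <= c] one roll leads at most [b] above [c], so the induction hypothesis applies to
     every outcome. *)
  transitivity (\sum_j weight j * \sum_(l < b) \sum_(i < n.+1)
     passage (kron l.+1%:Z) i (s + outcome (d := D) j - c) * passage v (n - i) (c + l.+1%:Z)).
    by apply: eq_bigr => j _; rewrite -IHn //; have := outcome_le j; lia.
  under eq_bigr do rewrite mulr_sumr.
  rewrite exchange_big; apply: eq_bigr => l _ /=.
  rewrite [RHS]big_ord_recl passage_le0 ?subr_le0 // mul0r add0r.
  under eq_bigr do rewrite mulr_sumr.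
  rewrite exchange_big; apply: eq_bigr => i _.
  rewrite [passage _ (lift _ _) _]passage_le0 ?subr_le0 //= mulr_suml subSS; apply: eq_bigr => j _.
  by rewrite -mulrA addrAC.
Qed.

(** A first passage from [s <= b] lands between 1 and [b], so these landing points exhaust all
    cases. *)
Lemma sum_passage_kron n s : s <= b%:Z ->
  \sum_(l < b) passage (kron l.+1%:Z) n s = passage (fun=> 1) n s.
Proof.
elim: n s => [|n IHn] s s_le; have [s_gt0|s_le0] := ltP 0 s.
- have lt_sb : (`|s|.-1 < b)%N by lia.
  rewrite (bigD1 (Ordinal lt_sb)) //= s_gt0 big1 => [|l].
    by rewrite addr0 /kron; case: eqP => //; lia.
  by rewrite -val_eqE /= /kron => ne; case: eqP => // sE; move: ne; rewrite sE eqxx.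
- by rewrite passage_le0 // big1 // => l _; rewrite passage_le0.
- by rewrite passage_gt0 // big1 // => l _; rewrite passage_gt0.
- rewrite passage_le0 //; under eq_bigr do rewrite passage_le0 //.
  rewrite exchange_big; apply: eq_bigr => j _ /=.
  by rewrite -mulr_sumr IHn //; have := outcome_le j; lia.
Qed.

Definition passage_fps v s : fps R := FPS (passage v ^~ s).

Lemma passage_fps_ladder v c s : c <= 0 -> s - c <= b%:Z -> passage_fps v s =
  \sum_(l < b) passage_fps (kron l.+1%:Z) (s - c) * passage_fps v (c + l.+1%:Z).
Proof.
by move=> c_le0 s_le; apply: fps_ext => n; rewrite fps_coef_sum /= (@passage_ladder _ _ c).
Qed.

Lemma passage_fps_step v s : s <= 0 -> passage_fps v s =
  \sum_j fps_of_poly ('X * (weight j)%:P) * passage_fps v (s + outcome (d := D) j).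
Proof.
move=> s_le0; under eq_bigr do rewrite rmorphM -mulrA; rewrite -mulr_sumr.
apply: fps_ext => -[|n]; first by rewrite fps_coef_XM0 /= ltNge s_le0.
rewrite fps_coef_XM fps_coef_sum [LHS]/= ltNge s_le0; apply: eq_bigr => j _.
by rewrite fps_coef_CM.
Qed.

Section KernelRoots.
Variables (L : comNzRingType) (psi : {rmorphism fps R -> L}) (w : L).
Hypothesis ladder_root :
  w ^+ b = \sum_(l < b) psi (passage_fps (kron l.+1%:Z) 0) * w ^+ (b - l.+1).

(* Powers of w modulo the ladder polynomial are read off the first passage
   from b - m, since both obey the same recurrence in m. *)
Lemma ladder_root_pow m : w ^+ m =
  \sum_(k < b) psi (passage_fps (kron (b%:Z - k%:Z)) (b%:Z - m%:Z)) * w ^+ k.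
Proof.
elim/ltn_ind: m => m IHm; have [lt_mb|le_bm] := ltnP m b.
  (* For [m < b] the start [b - m] is already positive: passage is immediate and the expansion is
     the single power [w ^+ m]. *)
  have passageE (k : 'I_b) : passage_fps (kron (b%:Z - k%:Z)) (b%:Z - m%:Z) = (m == k)%:R.
    apply: fps_ext => n; have s_gt0 : 0 < b%:Z - m%:Z by lia.
    rewrite /= passage_gt0 // /kron.
    have -> : (b%:Z - m%:Z == b%:Z - k%:Z) = (m == k) by apply/eqP/eqP; lia.
    by case: n => [|n]; case: (m == k).
  rewrite (bigD1 (Ordinal lt_mb)) // passageE eqxx rmorph1 mul1r big1 /= ?addr0 // => k.
  by rewrite -val_eqE passageE eq_sym => /negPf ->; rewrite rmorph0 mul0r.
have bm : b%:Z - m%:Z <= 0 by lia.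
(* The ladder recurrence at the level [c = b - m] of the start itself replaces [m] by [m - l.+1],
   just as the equation satisfied by [w] does. *)
under eq_bigr => k _.
  rewrite (passage_fps_ladder _ bm) ?subrr // rmorph_sum mulr_suml; over.
rewrite exchange_big /= -{1}(subnK le_bm) exprD ladder_root mulr_sumr.
apply: eq_bigr => l _; rewrite mulrCA -exprD.
have -> : (m - b + (b - l.+1) = m - l.+1)%N by have := ltn_ord l; lia.
rewrite IHm; last by have := ltn_ord l; lia.
rewrite mulr_sumr; apply: eq_bigr => k _; rewrite rmorphM mulrA.
by congr (_ * psi (passage_fps _ _) * _); have := ltn_ord l; lia.
Qed.

(** The expansion of [w ^+ b] is that of the start 0. One roll leads from there to
    [outcome j = b - m j], whose expansion is that of [w ^+ m j]. *)
Lemma kernel_root (m : 'I_(faces D) -> nat) :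
    (forall j, (m j)%:Z = b%:Z - outcome (d := D) j) ->
  w ^+ b = \sum_j psi (fps_of_poly ('X * (weight j)%:P)) * w ^+ m j.
Proof.
move=> mE; rewrite ladder_root_pow.
under eq_bigr do rewrite subrr passage_fps_step // rmorph_sum mulr_suml.
rewrite exchange_big; apply: eq_bigr => j _ /=.
rewrite [w ^+ m j]ladder_root_pow mulr_sumr; apply: eq_bigr => k _.
rewrite rmorphM mulrA; congr (_ * psi (passage_fps _ _) * _).
by have := mE j; lia.
Qed.

End KernelRoots.
End FirstPassage.

(** * The law of the number of rounds *)

Section Probability.
Context (d : measure_display) (T : measurableType d) (R : realType).
Variable Pr : probability T R.

(** The events need to cover the space only up to a null set: a roll may take values other than the
    outcomes, with probability 0. *)
Lemma total_probability n (B : 'I_n -> set T) (A : set T) :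
    measurable A -> (forall i, measurable (B i)) -> trivIset setT B ->
    (\sum_i Pr (B i))%E = 1%E ->
  Pr A = (\sum_i Pr (A `&` B i))%E.
Proof.
move=> mA mB tB B1; pose U := \big[setU/set0]_i B i.
have mU : measurable U by apply: bigsetU_measurable.
have PU : Pr U = 1%E by rewrite measure_bigsetU_ord.
rewrite (measureDI _ mA mU) [X in (X + _)%E](_ : _ = 0%E) ?add0e.
  rewrite /U big_distrr /= measure_bigsetU_ord //.
    by move=> i; apply: measurableI.
  by apply/trivIsetP => i j _ _ ij; rewrite setIACA (trivIsetP.1 tB) // setI0.
apply: (@subset_measure0 _ _ _ _ _ (~` U)).
- exact: measurableD.
- exact: measurableC.
- by move=> x [].
- by have := probability_setC Pr mU; rewrite PU subee.
Qed.

Variables (D : die R) (xi : nat -> {RV Pr >-> R}).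
Hypothesis rolls : independent_rolls D xi.
Implicit Type js : seq 'I_(faces D).

Let value js : seq R := [seq (outcome j)%:~R | j <- js].
Let position js : int := \sum_(j <- js) outcome j.

Let cylinder js : set T :=
  \bigcap_(n in [set` iota 0 (size js)]) (xi n @^-1` [set (value js)`_n]).

Let measurable_roll n x : measurable (xi n @^-1` [set x]).
Proof. by rewrite -[X in measurable X]setTI; apply: measurable_funP. Qed.

Let measurable_cylinder js : measurable (cylinder js).
Proof.
by apply: fin_bigcap_measurable => // n _; apply: measurable_roll.
Qed.

Let prob_roll n j : Pr (xi n @^-1` [set (outcome (d := D) j)%:~R]) = (weight j)%:E.
Proof. by rewrite -(rolls.1 n j) /pmf fineK // fin_num_measure. Qed.

Let prob_cylinder js : Pr (cylinder js) = (\prod_(j <- js) weight j)%:E.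
Proof.
rewrite /cylinder (rolls.2 _ (fun n => [set (value js)`_n])) ?iota_uniq //.
case: js => [|j0 js']; first by rewrite !big_nil.
set js := j0 :: js'; have -> : iota 0 (size js) = index_iota 0 (size js).
  by rewrite /index_iota subn0.
rewrite [in RHS](big_nth j0) !big_mkord -prodEFin; apply: eq_bigr => i _.
by rewrite /value (nth_map j0) // prob_roll.
Qed.

Let cylinder_rcons js j :
  cylinder (rcons js j) = cylinder js `&` xi (size js) @^-1` [set (outcome j)%:~R].
Proof.
have valueE i : (i < size js)%N -> (value (rcons js j))`_i = (value js)`_i.
  by move=> lt_i; rewrite /value map_rcons nth_rcons size_map lt_i.
have lastE : (value (rcons js j))`_(size js) = (outcome j)%:~R.
  by rewrite /value map_rcons nth_rcons size_map ltnn eqxx.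
have iotaP m i : [set` iota 0 m] i = (i < m)%N :> Prop by rewrite /= mem_iota.
apply/seteqP; split=> w; rewrite /cylinder size_rcons.
  move=> cw; split=> [i|].
    rewrite iotaP => lt_i; rewrite -valueE //; apply: (cw i).
    by rewrite iotaP ltnS ltnW.
  by rewrite -lastE; apply: (cw (size js)); rewrite iotaP.
move=> [cw lw] i; rewrite iotaP ltnS leq_eqVlt => /predU1P[->|lt_i].
  by rewrite lastE.
by rewrite valueE //; apply: (cw i); rewrite iotaP.
Qed.

Let capital_cylinder js k w : cylinder js w -> (k <= size js)%N ->
  capital (fun n => xi n) k w = (position (take k js))%:~R.
Proof.
move=> cw le_k; rewrite /capital /position rmorph_sum /=.
transitivity (\sum_(x <- take k (value js)) x); last first.
  by rewrite /value -map_take big_map.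
rewrite (big_nth 0) size_take_min size_map (minn_idPl le_k) big_mkord.
apply: eq_bigr => i _; rewrite nth_take //; apply: (cw i).
by rewrite /= mem_iota (leq_trans _ le_k).
Qed.

Lemma rounds_SomeP w n : rounds (fun n => xi n) w = Some n <->
  0 < capital (fun n => xi n) n w /\ forall k, (k < n)%N -> capital (fun n => xi n) k w <= 0.
Proof.
rewrite /rounds; case: pselect => [ex|nex]; last first.
  by split=> // -[gt0 _]; case: nex; exists n.
case: ex_minnP => m gt0 min_m; split=> [[<-]|[gt0_n le0]].
  by split=> // k; rewrite leNgt; apply: contraL => /min_m; rewrite -leqNgt.
congr Some; apply/eqP; rewrite eqn_leq min_m //= leqNgt; apply/negP => /le0.
by rewrite leNgt gt0.
Qed.

Lemma measurable_rounds n : measurable [set w | rounds (fun n => xi n) w = Some n].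
Proof.
have mcap k : measurable_fun setT (capital (fun n => xi n) k : T -> R).
  rewrite /capital; apply: (@measurable_sum _ _ _ _ _ _ (fun i : 'I_k => xi i : T -> R)) => i.
  exact: measurable_funP.
rewrite (_ : [set w | _] = (capital (fun n => xi n) n @^-1` `]0, +oo[) `&`
   \bigcap_(k in `I_n) (capital (fun n => xi n) k @^-1` `]-oo, 0])).
  apply: measurableI.
    by rewrite -[X in measurable X]setTI; apply: mcap.
  apply: fin_bigcap_measurable => // k _.
  by rewrite -[X in measurable X]setTI; apply: mcap.
apply/seteqP; split=> w /=.
  move/rounds_SomeP => [gt0 le0]; split; first by rewrite in_itv /= gt0.
  by move=> k /= lt_k; rewrite in_itv /= le0.
move=> [gt0 le0]; apply/rounds_SomeP; split; first by move: gt0; rewrite in_itv /= andbT.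
by move=> k lt_k; have := le0 k lt_k; rewrite /= in_itv.
Qed.

(** Induction on the number of rounds left after the prefix [js]; splitting over the next roll
    reproduces the recursion of [passage]. The last position of [js] may be positive, the earlier
    ones not. *)
Let prob_rounds_cylinder n js : (size js <= n)%N ->
    (forall k, (k < size js)%N -> position (take k js) <= 0) ->
  Pr ([set w | rounds (fun n => xi n) w = Some n] `&` cylinder js) =
  ((\prod_(j <- js) weight j) * passage D (fun=> 1) (n - size js) (position js))%:E.
Proof.
move Em: (n - size js)%N => m; elim: m js Em => [|m IHm] js Em le_n le0.
  have Enj : n = size js by apply/eqP; rewrite eqn_leq le_n -subn_eq0 Em eqxx.
  have capn w : cylinder js w -> capital (fun n => xi n) n w = (position js)%:~R.
    by move=> cw; rewrite (capital_cylinder cw) Enj // take_size.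
  rewrite /=; case: ltP => [gt0|pos_le0].
    (* The cylinder fixes all [n] rolls and lies inside the event; its probability is where
       independence enters. *)
    rewrite mulr1 -prob_cylinder; congr (Pr _); apply/setIidPr => w cw.
    apply/rounds_SomeP; split; first by rewrite capn // ltr0z.
    move=> k lt_k; rewrite (capital_cylinder cw); last by rewrite -Enj ltnW.
    by rewrite lerz0 le0 // -Enj.
  rewrite mulr0 (_ : _ `&` _ = set0) ?measure0 //; apply/seteqP; split=> // w.
  by move=> [/rounds_SomeP[+ _] cw]; rewrite capn // ltr0z ltNge pos_le0.
have lt_n : (size js < n)%N by rewrite -subn_gt0 Em.
have [gt0|pos_le0] := ltP 0 (position js).
  rewrite passage_gt0 // mulr0 (_ : _ `&` _ = set0) ?measure0 //.
  apply/seteqP; split=> // w [/rounds_SomeP[_ /(_ _ lt_n)] + cw].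
  by rewrite (capital_cylinder cw) // take_size lerz0 leNgt gt0.
rewrite passage_le0 //.
rewrite (@total_probability _
  (fun j => xi (size js) @^-1` [set (outcome (d := D) j)%:~R])); last first.
- under eq_bigr do rewrite prob_roll.
  by rewrite sumEFin weight_sum1.
- apply/trivIsetP => i j _ _ ne_ij; rewrite -preimage_setI.
  rewrite (_ : _ `&` _ = set0) ?preimage_set0 //.
  apply/seteqP; split=> // x [/= -> /eqP]; rewrite eqr_int => /eqP/outcome_inj ij.
  by rewrite ij eqxx in ne_ij.
- by move=> j; apply: measurable_roll.
- by apply: measurableI; [apply: measurable_rounds | apply: measurable_cylinder].
rewrite mulr_sumr -sumEFin; apply: eq_bigr => j _.
rewrite -setIA -cylinder_rcons IHm ?size_rcons //; last 2 first.
- by rewrite subnS Em.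
- move=> k; rewrite ltnS => le_k; rewrite -cats1 takel_cat //.
  by move: le_k; rewrite leq_eqVlt => /predU1P[->|/le0 //]; rewrite take_size.
by rewrite /position -cats1 !big_cat /= !big_seq1 mulrA.
Qed.

(** The case of the empty prefix, whose cylinder is the whole space. *)
Lemma pgf_rounds n : pgf Pr (rounds (fun n => xi n)) n = passage D (fun=> 1) n 0.
Proof.
rewrite /pgf; have := @prob_rounds_cylinder n [::] isT.
rewrite /cylinder /= set_nil bigcap_set0 setIT subn0 /position !big_nil mul1r.
by move=> ->.
Qed.

End Probability.

(** * The algorithm *)

Section NewtonComputable.
Variable R : realType.

Lemma computable_course (A X : Type) (eA : A -> tree R) (eX : X -> tree R)
    (step : X -> seq A -> A) (n : X -> nat) :
    computable (enc_pair eX (enc_seq eA)) eA (fun u => step u.1 u.2) ->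
    computable eX enc_nat n ->
  computable eX (enc_seq eA) (fun x => course (step x) (n x)).
Proof.
move=> cstep cn; apply: (computable_iter (body := fun x s => rcons s (step x s))) => //.
  by apply: computable_rcons => //; comp_proj.
exact: computable_nil.
Qed.

Variables (A : comNzRingType) (eA : A -> tree R).
Hypothesis cA : computable_ring eA.
Variables (X : Type) (eX : X -> tree R).

Lemma computable_newton_psum (r : X -> nat -> A) (n : X -> nat) :
    computable (enc_pair eX enc_nat) eA (fun u => r u.1 u.2) ->
    computable eX enc_nat n ->
  computable eX eA (fun x => newton_psum (r x) (n x)).
Proof.
move=> cr cn; have cstep : computable (enc_pair eX (enc_seq eA)) eA
    (fun u => psum_step (r u.1) u.2).
  rewrite /psum_step; apply: (computable_opp cA); apply: (computable_add cA).
    apply: (computable_mul cA); last apply: (computable_comp2 cr); comp_proj.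
      by apply: (computable_natr cA); apply: computable_size; comp_proj.
    by apply: computable_size; comp_proj.
  apply: (computable_sum_nat cA); last by apply: computable_size; comp_proj.
  apply: (computable_mul cA); first apply: (computable_comp2 cr); comp_proj.
    by apply: computable_subn; comp_proj; apply: computable_size; comp_proj.
  by apply: computable_nth; comp_proj; apply: (computable_ring0 cA).
apply: (computable_comp2 (op := fun x => psum_step (r x)) (f := id) cstep); comp_proj.
exact: (computable_course cstep cn).
Qed.

Lemma computable_newton_coef (inv : nat -> A) (p : X -> nat -> A) (n : X -> nat) :
    computable enc_nat eA inv ->
    computable (enc_pair eX enc_nat) eA (fun u => p u.1 u.2) ->
    computable eX enc_nat n ->
  computable eX eA (fun x => newton_coef inv (p x) (n x)).
Proof.
move=> cinv cp cn; have cstep : computable (enc_pair eX (enc_seq eA)) eA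
    (fun u => coef_step inv (p u.1) u.2).
  rewrite /coef_step; apply: computable_if; first apply: computable_eqn0.
  - by apply: computable_size; comp_proj.
  - exact: computable_ring1.
  apply: (computable_mul cA).
    apply: (computable_opp cA); apply: computable_comp cinv.
    by apply: computable_size; comp_proj.
  apply: (computable_sum_nat cA); last by apply: computable_size; comp_proj.
  apply: (computable_mul cA); last apply: (computable_comp2 cp); comp_proj.
    by apply: computable_nth; comp_proj; apply: (computable_ring0 cA).
  by apply: computable_subn; comp_proj; apply: computable_size; comp_proj.
apply: (computable_comp2 (op := fun x => coef_step inv (p x)) (f := id) cstep); comp_proj.
exact: (computable_course cstep cn).
Qed.

End NewtonComputable.

Section ProductPolyComputable.
Variables (R : realType) (A : comNzRingType) (eA : A -> tree R).
Hypothesis cA : computable_ring eA.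
Variables (X : Type) (eX : X -> tree R).

Lemma computable_product_poly (N : X -> {poly A}) (b : X -> nat) (inv : nat -> A) :
    computable eX (enc_poly eA) N -> computable eX enc_nat b ->
    computable enc_nat eA inv ->
  computable eX (enc_poly eA) (fun x => product_poly (N x) (b x) inv).
Proof.
move=> cN cb cinv; have cpoly := computable_ring_poly cA.
have cdeg : computable eX enc_nat (fun x => (size (N x)).-1).
  by apply: computable_pred; apply: computable_size_poly cN.
have clead : computable eX eA (fun x => lead_coef (N x)).
  exact: (computable_coef cA cN cdeg).
have cD : computable eX enc_nat (fun x => (size (N x)).-1 ^ b x)%N.
  exact: computable_expn.
rewrite /product_poly; apply: (computable_sum_nat cpoly); last exact: computable_succ.
apply: (computable_mul cpoly).
  apply: (computable_polyC cA); apply: (computable_newton_coef cA) => //; comp_proj.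
  apply: (computable_exp cA); last first.
    by apply: (computable_comp (f := fun u => u.1.1) _ cb); comp_proj.
  apply: (computable_newton_psum cA); comp_proj.
  rewrite /scaled_coef; apply: computable_if; first by apply: computable_eqn0; comp_proj.
    exact: computable_ring1.
  apply: (computable_mul cA).
    apply: (computable_exp cA); last by apply: computable_pred; comp_proj.
    by apply: (computable_comp (f := fun u => u.1.1.1) _ clead); comp_proj.
  apply: computable_nth; [exact: computable_ring0 | | by comp_proj].
  apply: computable_rev.
  by apply: (computable_comp (f := fun u => u.1.1.1) _ cN); comp_proj.
apply: (computable_exp cpoly).
  apply: (computable_mul cpoly).
    apply: (computable_polyC cA); apply: (computable_exp cA).
      by apply: (computable_comp (f := fun u => u.1) _ clead); comp_proj.
    by apply: (computable_comp (f := fun u => u.1) _ cb); comp_proj.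
  apply: (computable_add cpoly); first exact: computable_ring1.
  by apply: (computable_opp cpoly); apply: (computable_polyX cA).
apply: computable_subn; comp_proj.
by apply: (computable_comp (f := fun u => u.1) _ cD); comp_proj.
Qed.
End ProductPolyComputable.

(** * The annihilating polynomial of a die *)

Section Algorithm.
Variable R : realType.
Implicit Type l : seq (R * R).

(* Outcomes are integers, hence bounded by the sum of their squares. *)
Definition outcome_bound l : R := \sum_(x <- l) x.1 ^+ 2.

(* The kernel w^b - t \sum_j q_j w^(b - s_j) as a polynomial in 1 - w over R[t]. *)
Definition kernel_poly l : {poly {poly R}} :=
  (1 - 'X) ^+ natceil (outcome_bound l) -
  \sum_(x <- l) ('X * x.2%:P)%:P * (1 - 'X) ^+ natceil (outcome_bound l - x.1).

(** The number of factors is the outcome bound, which is the degree of the ladder polynomial. *)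
Definition annihilator l : {poly {poly R}} :=
  product_poly (kernel_poly l) (natceil (outcome_bound l)) (fun k => (k%:R^-1)%:P).

Definition enc_die : seq (R * R) -> tree R := enc_seq (enc_pair (@Leaf R) (@Leaf R)).

Lemma computable_annihilator :
  computable enc_die (enc_poly (enc_poly (@Leaf R))) annihilator.
Proof.
have c1 := computable_ring_num R; have c2 := computable_ring_poly c1.
have c3 := computable_ring_poly c2.
have cB : computable enc_die (@Leaf R) outcome_bound.
  apply: (computable_sum c1 (E := fun _ x => x.1 ^+ 2)); last exact: computable_id.
  apply: (computable_exp c1); comp_proj.
  exact/computable_succ/computable_succ/computable_nat0.
have cb : computable enc_die enc_nat (fun l => natceil (outcome_bound l)).
  exact: computable_natceil.
have c1X (X : Type) (eX : X -> tree R) :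
    computable eX (enc_poly (enc_poly (@Leaf R))) (fun=> 1 - 'X).
  apply: (computable_add c3); first exact: computable_ring1.
  by apply: (computable_opp c3); apply: (computable_polyX c2).
apply: (computable_product_poly c2) => //; last first.
  by apply: (computable_polyC c1); apply: computable_inv; apply: (computable_natr c1); comp_proj.
apply: (computable_add c3); first exact: (computable_exp c3).
apply: (computable_opp c3).
apply: (computable_sum c3 (E := fun l x => ('X * x.2%:P)%:P *
  (1 - 'X) ^+ natceil (outcome_bound l - x.1))); last exact: computable_id.
apply: (computable_mul c3).
  apply: (computable_polyC c2); apply: (computable_mul c2); first exact: (computable_polyX c1).
  by apply: (computable_polyC c1); comp_proj.
apply: (computable_exp c3) => //; apply: computable_natceil.
apply: (computable_add c1); last by apply: (computable_opp c1); comp_proj.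
by apply: (computable_comp (f := fun u => u.1) _ cB); comp_proj.
Qed.

Variable D : die R.
Let l := [seq ((outcome j)%:~R, weight j) | j <- enum 'I_(faces D)] : seq (R * R).

Lemma encode_dieE : encode_die D = enc_die l.
Proof. by rewrite /enc_die /enc_seq -map_comp; congr encode_seq; apply: eq_map. Qed.

Let b : nat := `|(\sum_j outcome (d := D) j ^+ 2)%R|%N.

Let outcome_boundE : outcome_bound l = b%:R.
Proof.
rewrite /outcome_bound big_map big_enum /= -[b%:R]/(b%:Z%:~R) /b gez0_abs; last first.
  by apply: sumr_ge0 => j _; apply: sqr_ge0.
by rewrite rmorph_sum; apply: eq_bigr => j _; rewrite rmorphXn.
Qed.

Let outcome_le j : outcome (d := D) j <= b%:Z.
Proof.
rewrite /b gez0_abs; last by apply: sumr_ge0 => i _; apply: sqr_ge0.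
rewrite (bigD1 j) //= ler_wpDr //; first by apply: sumr_ge0 => i _; apply: sqr_ge0.
by nia.
Qed.

Let m j : nat := `|(b%:Z - outcome (d := D) j)%R|%N.

Let mE j : (m j)%:Z = b%:Z - outcome j.
Proof. by rewrite /m gez0_abs // subr_ge0. Qed.

Let kernel_polyE : kernel_poly l = (1 - 'X) ^+ b -
  \sum_j ('X * (weight (d := D) j)%:P)%:P * (1 - 'X) ^+ m j.
Proof.
rewrite /kernel_poly outcome_boundE natceil_nat big_map big_enum /=; congr (_ - _).
apply: eq_bigr => j _; congr (_ * _ ^+ _).
have -> : b%:R - (outcome j)%:~R = (m j)%:R :> R by rewrite -[RHS]/((m j)%:Z%:~R) mE rmorphB.
exact: natceil_nat.
Qed.

(** At t = 0 only the power of [1 - 'X] is left. *)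
Let kernel_poly_neq0 : kernel_poly l != 0.
Proof.
have : map_poly (horner_eval (0 : R)) (kernel_poly l) != 0.
  rewrite kernel_polyE rmorphB rmorph_sum /= big1 => [|j _].
    rewrite subr0 rmorphXn rmorphB rmorph1 /= map_polyX expf_neq0 //.
    by rewrite -size_poly_gt0 -size_opp opprB size_XsubC.
  by rewrite rmorphM /= map_polyC /= /horner_eval hornerM hornerX mul0r mul0r.
by apply: contraNneq => ->; rewrite rmorph0.
Qed.

(** The index is shifted: [F k] belongs to landing at [k.+1]. *)
Let F k : fps R := passage_fps D (kron R k.+1%:Z) 0.

Let ladder : {poly fps R} := 'X^b - \sum_(k < b) (F k)%:P * 'X^(b - k.+1).

Let size_ladder_tail : (size (\sum_(k < b) (F k)%:P * 'X^(b - k.+1))%R <= b)%N.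
Proof.
apply: (big_ind (fun p : {poly fps R} => size p <= b)%N) => [|p q sp sq|k _].
- by rewrite size_poly0.
- by rewrite (leq_trans (size_polyD _ _)) // geq_max sp.
- rewrite mul_polyC (leq_trans (size_scale_leq _ _)) // size_polyXn.
  by have := ltn_ord k; lia.
Qed.

Let size_ladder : size ladder = b.+1.
Proof. by rewrite size_polyDl size_polyXn // size_polyN ltnS. Qed.

Let monic_ladder : ladder \is monic.
Proof.
by rewrite monicE lead_coefDl ?lead_coefXn // size_polyN size_polyXn ltnS.
Qed.

Lemma annihilator_correct :
  annihilator l != 0 /\ annihilates (annihilator l) (passage D (fun=> 1) ^~ 0).
Proof.
pose N := kernel_poly l; pose f := passage_fps D (fun=> 1) 0.
pose NK := map_poly (tofrac (R := fps R) \o fps_of_poly (R := R)) N.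
pose AK := map_poly (tofrac (R := fps R)) ladder.
have lead_N0 : tofrac (fps_of_poly (lead_coef N)) != 0.
  by rewrite tofrac_eq0 fps_of_poly_eq0 lead_coef_eq0.
have NK0 : NK != 0 by rewrite map_poly_eq0_id0.
have AK_monic : AK \is monic by apply: monic_map.
(* Splitting the product places the roots of the kernel and of the ladder polynomial in one field;
   each factor then splits there as a divisor. *)
have [L [iota [rs split_rs]]] := splitting_field (mulf_neq0 NK0 (monic_neq0 AK_monic)).
pose psi : {rmorphism fps R -> L} := iota \o tofrac (R := fps R).
pose phi : {rmorphism {poly R} -> L} := psi \o fps_of_poly (R := R).
have psi_eq0 g : (psi g == 0) = (g == 0) by rewrite fmorph_eq0 tofrac_eq0.
have phi_lead : phi (lead_coef N) != 0 by rewrite fmorph_eq0.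
have split_NA : map_poly phi N * map_poly psi ladder =
    iota (lead_coef (NK * AK)) *: \prod_(r <- rs) ('X - r%:P).
  by rewrite -split_rs rmorphM /= -!map_poly_comp.
have lead_NA : iota (lead_coef (NK * AK)) != 0.
  by rewrite fmorph_eq0 lead_coef_eq0 mulf_neq0 // monic_neq0.
have [zs N_zs] : exists zs, map_poly phi N = phi (lead_coef N) *: \prod_(z <- zs) ('X - z%:P).
  have [mz] : {mz | map_poly phi N %= \prod_(r <- mask mz rs) ('X - r%:P)}.
    by apply: dvdp_prod_XsubC; rewrite -(dvdpZr _ _ lead_NA) -split_NA dvdp_mulr.
  move/eqp_eq; rewrite (monicP (monic_prod_XsubC _ _ _)) scale1r => ->.
  by exists (mask mz rs); rewrite lead_coef_map_id0 ?rmorph0.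
have [ws A_ws] : exists ws, map_poly psi ladder = \prod_(w <- ws) ('X - w%:P).
  have [mw] : {mw | map_poly psi ladder %= \prod_(r <- mask mw rs) ('X - r%:P)}.
    by apply: dvdp_prod_XsubC; rewrite -(dvdpZr _ _ lead_NA) -split_NA dvdp_mull.
  rewrite eqp_monic ?monic_prod_XsubC ?monic_map // => /eqP ->.
  by exists (mask mw rs).
have size_ws : size ws = b.
  apply/succn_inj; rewrite -(size_prod_XsubC _ id) -A_ws -size_ladder.
  by rewrite size_map_poly_id0 // (monicP monic_ladder) rmorph1 oner_neq0.
have invE k : (0 < k)%N -> phi (k%:R^-1)%:P * k%:R = 1.
  move=> k_gt0; rewrite -(rmorph_nat phi) -rmorphM -polyC_natr -polyCM.
  by rewrite mulVf ?rmorph1 // pnatr_eq0 -lt0n.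
have ladderE x : (map_poly psi ladder).[x] =
    x ^+ b - \sum_(k < b) psi (F k) * x ^+ (b - k.+1).
  rewrite rmorphB rmorph_sum /= map_polyXn !hornerE horner_sum; congr (_ - _).
  by apply: eq_bigr => k _; rewrite rmorphM /= map_polyC map_polyXn !hornerE.
have ws_zs : {subset [seq 1 - w | w <- ws] <= zs}.
  move=> _ /mapP[w w_ws ->].
  have w_ladder : w ^+ b = \sum_(k < b) psi (F k) * w ^+ (b - k.+1).
    apply/eqP; rewrite -subr_eq0 -ladderE A_ws.
    by rewrite -[_ == 0]/(root _ w) root_prod_XsubC.
  have w_kernel := kernel_root outcome_le w_ladder mE.
  (* At [1 - w] the powers of [1 - 'X] become powers of [w], so the claim is the kernel equation. *)
  rewrite -(root_prod_XsubC zs) -(rootZ _ _ phi_lead) -N_zs /root /N kernel_polyE.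
  rewrite rmorphB rmorphXn rmorph_sum /= hornerD hornerN horner_exp horner_sum.
  rewrite rmorphB rmorph1 /= map_polyX hornerD hornerN hornerX hornerC subKr.
  rewrite w_kernel subr_eq0; apply/eqP; apply: eq_bigr => j _.
  rewrite [in RHS]rmorphM [in RHS]rmorphXn rmorphB rmorph1 /= map_polyC map_polyX.
  by rewrite !hornerE subKr.
(* The value of the ladder polynomial at 1 is one minus the sum of the [F k], that is [1 - f], and
   also the product of the [1 - w]. *)
have psi_f : psi f = 1 - \prod_(z <- [seq 1 - w | w <- ws]) z.
  have -> : f = \sum_(k < b) F k.
    apply: fps_ext => n; rewrite fps_coef_sum /=.
    by rewrite (sum_passage_kron outcome_le).
  have := ladderE 1; rewrite A_ws horner_prod expr1n big_map.
  under eq_bigr do rewrite hornerXsubC.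
  move=> ->; rewrite subKr rmorph_sum; apply: eq_bigr => k _.
  by rewrite expr1n mulr1.
have size_ws' : size [seq 1 - w | w <- ws] = natceil (outcome_bound l).
  by rewrite size_map size_ws outcome_boundE natceil_nat.
split; first exact: (product_poly_neq0 _ phi_lead N_zs invE).
move=> n; rewrite -[_ ^~ 0]/(fps_coef f) fps_subst_horner.
suff /eqP -> : (map_poly (fps_of_poly (R := R)) (annihilator l)).[f] == 0 by [].
(* Since [psi] is injective, the root may be checked in [L], where [f] is known through the
   roots. *)
rewrite -psi_eq0 -horner_map -map_poly_comp psi_f.
exact: (root_product_poly phi_lead N_zs invE size_ws' ws_zs).
Qed.
End Algorithm.

Theorem theorem6 (R : realType) :
  (forall D : die R, 0 < expected_gain D ->
     forall (d : measure_display) (T : measurableType d)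
            (Pr : probability T R) (xi : nat -> {RV Pr >-> R}),
       independent_rolls D xi ->
       algebraic_fps (pgf Pr (rounds (fun n => xi n)))) /\
  (exists A : program, forall D : die R, 0 < expected_gain D ->
     exists P : {poly {poly R}},
       [/\ run A (encode_die D) (encode_poly2 P),
           P != 0
         & forall (d : measure_display) (T : measurableType d)
                  (Pr : probability T R) (xi : nat -> {RV Pr >-> R}),
             independent_rolls D xi ->
             annihilates P (pgf Pr (rounds (fun n => xi n)))]).
Proof.
pose l (D : die R) := [seq ((outcome j)%:~R, weight j) | j <- enum 'I_(faces D)] : seq (R * R).
have correct (D : die R) d (T : measurableType d) (Pr : probability T R)
    (xi : nat -> {RV Pr >-> R}) : independent_rolls D xi ->
  annihilates (annihilator (l D)) (pgf Pr (rounds (fun n => xi n))).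
  move=> rolls; have [_] := annihilator_correct D.
  by rewrite (_ : pgf _ _ = passage D (fun=> 1) ^~ 0) //; apply/funext/pgf_rounds.
split=> [D _ d T Pr xi rolls|].
  exists (annihilator (l D)); split; last exact: correct.
  by have [] := annihilator_correct D.
(* The program is obtained before any die is given, hence is uniform in it. *)
have [A runA] := computable_annihilator R; exists A => D _.
exists (annihilator (l D)); split=> [||d T Pr xi]; last exact: correct.
  by rewrite encode_dieE; apply: runA.
by have [] := annihilator_correct D.
Qed.
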